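(* Consider the birth and death chain on $\{0,\dots,n\}$ described in the context. Define $G:=\{n/2,n/2+1,\dots,n\}$, let $\alpha\in(0,1)$, and let $n$ be large enough that $n^\alpha<n/2$. Then HpG (that is, condition $Hp.G(R,d,f,r)$ for the set $A=\{0,\dots,n\}\setminus G$, with $d,f,r=o(1)$ as $n\to\infty$) holds with $n^{5/2-\varepsilon}\ll R$ for small enough $\varepsilon$.
   Context: The birth and death chain: continuous-time Markov chain on $\mathcal X=\{0,\dots,n\}$ with invariant measure $$\pi(x)=Z^{-1}\frac{1}{(x\vee1)^{3/2}\,((n-x)\vee1)^{3/2}},$$ $Z=Z(n)$ the normalization constant, and Metropolis rates $Q(x,x+1)=b(x)=\min\{1,\pi(x+1)/\pi(x)\}$ (birth) and $Q(x,x-1)=d(x)=\min\{1,\pi(x-1)/\pi(x)\}$ (death), with no other jumps. Notation: $o(1)$ denotes a positive quantity with limit $0$ as $n\to\infty$, and $b_n\ll a_n$ means $b_n/a_n=o(1)$. The dependence of $R,d,f,r$ on $n$ is not written. General hypotheses. For an irreducible continuous-time Markov chain $X$ on a finite set $\mathcal X$ with invariant probability $\pi$, $X^{\leftarrow}$ denotes the time-reversed chain, so that $\pi(z)\mathbf P(X^z_t=y)=\pi(y)\mathbf P(X^{\leftarrow y}_t=z)$. A superscript $x$ (or a probability measure) denotes the starting point (or initial law); $\tau^x_K=\inf\{t\ge0:X^x_t\in K\}$, and $\tau^{\leftarrow x}_K$ is the same for $X^{\leftarrow}$. For $G\subset\mathcal X$, $A=\mathcal X\setminus G$ and $\pi_A(\cdot)=\pi(\cdot)\mathbf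 1_{\{\cdot\in A\}}/\pi(A)$. Set $d_{TV}(\pi_1,\pi_2)=\frac12\sum_x|\pi_1(x)-\pi_2(x)|$, $\mu^x_t(\cdot)=\mathbf P(X^x_t=\cdot)$, $\bar d_K(t)=\max_{x,x'\in K}d_{TV}(\mu^x_t,\mu^{x'}_t)$, and $f_A(t):=\mathbf P(\tau_G^{\pi_A}\le t)=\frac12\sum_{x\in A}\pi_A(x)\left[\mathbf P(\tau^x_G\le t)+\mathbf P(\tau^{\leftarrow x}_G\le t)\right]$. For $R>1$, $d,f,r\in(0,1)$, $\alpha\in(0,1)$: - $E(R,f)$ (slow escape): $f_A(2R)\le f$. - $B_\alpha:=\left\{x\in A:\ \frac12\left[\mathbf P(\tau_G^x\le2R)+\mathbf P(\tau_G^{\leftarrow x}\le2R)\right]\le f^\alpha\right\}$. - $T(R,d)$ (fast thermalization): $\bar d_{B_\alpha}(R)\le d$. - $Rc(R,r)$ (fast recurrence): $\sup_{x\in\mathcal X}\mathbf P(\tau^x_{B_\alpha\cup G}>R)<r$. - $Hp.G(R,d,f,r)$: $E(R,f)$, $T(R,d)$ and $Rc(R,r)$ hold simultaneously. *)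

(* Defs.v *)
From HB Require Import structures.
From mathcomp Require Import all_boot all_order all_algebra.
From mathcomp Require Import all_classical all_reals all_analysis.
Set Implicit Arguments.
Unset Strict Implicit.
Unset Printing Implicit Defensive.
Import Order.TTheory GRing.Theory Num.Theory.
Import numFieldNormedType.Exports.
Local Open Scope classical_set_scope.
Local Open Scope ring_scope.

Section AsymptoticNotation.
Variable R : realType.
Implicit Types u a b : nat -> R.

Definition is_o1 u := (\forall n \near \oo, 0 < u n) /\ u n @[n --> \oo] --> 0.

Definition much_less b a := is_o1 (fun n => b n / a n).

End AsymptoticNotation.

Section MarkovChains.
Variable R : realType.

(* Q-matrix with off-diagonal jump rates q; q x x is ignored. *)
Definition generator (N : nat) (q : 'I_N.+1 -> 'I_N.+1 -> R) : 'M[R]_N.+1 :=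
  \matrix_(x, y) if x == y then - \sum_(z | z != x) q x z else q x y.

(* Entries of exp (t Q). *)
Definition transition (N : nat) (Q : 'M[R]_N.+1) (t : R) (x y : 'I_N.+1) : R :=
  limn (series (fun k => t ^+ k / (k`!)%:R * (Q ^+ k) x y)).

Variable S : finType.
Implicit Types (p : R -> S -> S -> R) (pi : S -> R) (K A G : {set S}).

Definition reversed pi p : R -> S -> S -> R :=
  fun t y z => pi z * p t z y / pi y.

(* mc_X x is the chain started at x; only times t >= 0 are meaningful.
   In mc_fdd, i ranges over 0, ..., m, and since t 0 = 0 the factor
   (y 0 == x) is the initial law. *)
Record markov_chain p := MarkovChain {
  mc_disp : measure_display;
  mc_space : measurableType mc_disp;
  mc_P : probability mc_space R;
  mc_X : S -> R -> mc_space -> S;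
  mc_measurable : forall x t y, 0 <= t ->
    measurable [set w | mc_X x t w = y]%classic;
  mc_rcont : forall x w t, 0 <= t ->
    \forall s \near t^'+, mc_X x s w = mc_X x t w;
  mc_fdd : forall (x : S) (m : nat) (t : nat -> R) (y : nat -> S),
    t 0%N = 0 -> (forall i, t i <= t i.+1) ->
    mc_P [set w | forall i, (i <= m)%N -> mc_X x (t i) w = y i]%classic =
    ((y 0%N == x)%:R * \prod_(i < m) p (t i.+1 - t i) (y i) (y i.+1))%:E
}.

(* mu^x_t *)
Definition law p (X : markov_chain p) (x : S) (t : R) (y : S) : R :=
  fine (mc_P X [set w | mc_X x t w = y]%classic).

(* Valued in \bar R: the infimum of the empty set is +oo. *)
Definition hitting_time p (X : markov_chain p) (x : S) K (w : mc_space X)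
    : \bar R :=
  ereal_inf [set t%:E | t in [set t : R | 0 <= t /\ mc_X x t w \in K]]%classic.

Definition prob_hit_le p (X : markov_chain p) (x : S) K (t : R) : R :=
  fine (mc_P X [set w | (hitting_time x K w <= t%:E)%E]%classic).

Definition prob_hit_gt p (X : markov_chain p) (x : S) K (t : R) : R :=
  fine (mc_P X [set w | (t%:E < hitting_time x K w)%E]%classic).

Definition dTV (mu nu : S -> R) : R := 2^-1 * \sum_x `|mu x - nu x|.

(* All maxima below are over nonnegative quantities, hence the default 0. *)
Definition dbar p (X : markov_chain p) K (t : R) : R :=
  \big[Num.max/0]_(x in K) \big[Num.max/0]_(x' in K)
    dTV (law X x t) (law X x' t).

Definition restricted pi A (x : S) : R :=
  (if x \in A then pi x else 0) / \sum_(z in A) pi z.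

Section Hypotheses.
Variables (pi : S -> R) (p : R -> S -> S -> R).
Variables (X : markov_chain p) (Xrev : markov_chain (reversed pi p)).
Variables (G : {set S}) (alpha : R).

Definition avg_hit (x : S) (t : R) : R :=
  2^-1 * (prob_hit_le X x G t + prob_hit_le Xrev x G t).

(* This is P(tau_G <= t) for the chain with initial law pi_A: by time reversal
   the X and Xrev contributions are equal. *)
Definition f_A (t : R) : R :=
  2^-1 * \sum_(x in ~: G) restricted pi (~: G) x *
           (prob_hit_le X x G t + prob_hit_le Xrev x G t).

Definition B_alpha (T f : R) : {set S} :=
  [set x in ~: G | avg_hit x (2 * T) <= f `^ alpha]%SET.

Definition slow_escape (T f : R) : Prop := f_A (2 * T) <= f.

Definition fast_thermalization (T d f : R) : Prop :=
  dbar X (B_alpha T f) T <= d.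

Definition fast_recurrence (T f r : R) : Prop :=
  \big[Num.max/0]_x prob_hit_gt X x (B_alpha T f :|: G) T < r.

Definition HpG (T d f r : R) : Prop :=
  [/\ slow_escape T f, fast_thermalization T d f & fast_recurrence T f r].

End Hypotheses.
End MarkovChains.

Section BirthAndDeath.
Variables (R : realType) (n : nat).

Definition bd_weight (x : 'I_n.+1) : R :=
  ((maxn x 1)%:R `^ (3 / 2) * (maxn (n - x) 1)%:R `^ (3 / 2))^-1.

Definition bd_pi (x : 'I_n.+1) : R := (\sum_z bd_weight z)^-1 * bd_weight x.

(* Metropolis rates between nearest neighbours. *)
Definition bd_rate (x y : 'I_n.+1) : R :=
  if (y == x.+1 :> nat) || (x == y.+1 :> nat)
  then Num.min 1 (bd_pi y / bd_pi x) else 0.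

Definition bd_transition : R -> 'I_n.+1 -> 'I_n.+1 -> R :=
  transition (generator bd_rate).

Definition bd_G : {set 'I_n.+1} := [set x : 'I_n.+1 | (n <= 2 * x)%N]%SET.

End BirthAndDeath.

Arguments bd_pi : clear implicits.
Arguments bd_transition : clear implicits.

(* Main.v *)
(* Let L be the generator and 1/inv_weight the reversible weight, so that edge
   {y, y+1} has resistance resist y.  Two explicit functions do all the work.
   The potential h (escape), equal to 0 at 0, 1 on G and harmonic in between,
   satisfies L h <= kappa everywhere with kappa of order n^(-5/2); hence
   P_x(tau_G <= t) <= h x + kappa t, and pi_A (h) is of order n^(-1/2).  The
   parabola phi satisfies L phi <= -1/4 between 0 and G, so {0} u G is reached
   within time T except with probability O(n^2 / T).  The latter gives fast
   recurrence, since 0 belongs to B_alpha, and also P_x(tau_G <= 2T) >= h x -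
   O(n^2 / T), so h is small on B_alpha.  Two copies started at x <= y have met
   once the upper one is at 0, whence dTV <= h y + O(n^2 / T).  All errors vanish
   for T = n^(5/2 - eps/2).  The finitely many remaining n only require the
   bounds to be below 1: there T is taken huge, and f is bounded away from 1 by
   the probability of never jumping.

   Every comparison is proved for the Euler scheme (1 + tL/k)^k, which preserves
   order, and passed to the limit; hitting times are limits of dyadic
   skeletons. *)

Require Import Defs.
From HB Require Import structures.
From mathcomp Require Import all_boot all_order all_algebra.
From mathcomp Require Import all_classical all_reals all_analysis.
From mathcomp Require Import ring lra zify.
Set Implicit Arguments.
Unset Strict Implicit.
Unset Printing Implicit Defensive.
Import Order.TTheory GRing.Theory Num.Theory.
Import numFieldNormedType.Exports.
Local Open Scope classical_set_scope.
Local Open Scope ring_scope.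

(** * Matrix exponentials as limits of the Euler scheme *)

(** With [b = a / N], both sides are [N]-th powers: [1 + b <= expR b] gives the upper bound, while
    [expR b * (1 - b) <= 1] gives [expR b * (1 - b ^+ 2) <= 1 + b], which Bernoulli's inequality
    turns into an error of order [1 / N]. *)
Lemma euler_expR (R : realType) (a : R) : 0 <= a ->
  (1 + a / n.+1%:R) ^+ n.+1 @[n --> \oo] --> expR a.
Proof.
move=> a0.
suff h : forall n, expR a - expR a * a ^+ 2 / n.+1%:R <= (1 + a / n.+1%:R) ^+ n.+1
    <= expR a.
  apply: (@squeeze_cvgr _ _ _ _ (fun n => expR a - expR a * a ^+ 2 * n.+1%:R^-1)
    (fun=> expR a)); last 2 first.
  - rewrite -[X in _ --> X]subr0 -[X in _ - X](mulr0 (expR a * a ^+ 2)).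
    by apply: cvgB; [exact: cvg_cst|apply: cvgMl_tmp; exact: cvg_harmonic].
  - exact: cvg_cst.
  - by near=> n; exact: h.
move=> n; set N : R := n.+1%:R.
have N0 : 0 < N by rewrite ltr0n.
set b := a / N.
have b0 : 0 <= b by rewrite divr_ge0 ?(ltW N0).
have bN : b * N = a by rewrite /b mulfVK// gt_eqF.
have -> : expR a = expR b ^+ n.+1 by rewrite -expRM_natr bN.
apply/andP; split; last first.
  by apply: lerXn2r (expR_ge1Dx b); rewrite nnegrE ?expR_ge0// addr_ge0.
rewrite (_ : expR b ^+ n.+1 - _ = expR b ^+ n.+1 * (1 - a ^+ 2 / N)); last ring.
have h1 : expR b * (1 - b ^+ 2) <= 1 + b.
  have h2 := expR_ge1Dx (- b).
  have h3 : expR b * expR (- b) = 1 by exact: expRxMexpNx_1.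
  have h4 : expR b * (1 - b) <= 1 by rewrite -[leRHS]h3 ler_wpM2l ?expR_ge0.
  rewrite (_ : _ * _ = expR b * (1 - b) * (1 + b)); last by ring.
  by rewrite ler_piMl ?addr_ge0.
have h2 : 0 <= 1 + b by lra.
(* Bernoulli's inequality needs [b ^+ 2 <= 1]; otherwise the lower bound is nonpositive. *)
have [b1|b1] := lerP (b ^+ 2) 1; last first.
  have h3 : 1 <= a ^+ 2 / N.
    have -> : a ^+ 2 / N = b ^+ 2 * N.
      by rewrite -bN expr2 expr2; field; rewrite gt_eqF.
    have : 1 <= N by rewrite ler1n.
    nra.
  apply: (@le_trans _ _ 0); last by rewrite exprn_ge0.
  by rewrite mulr_ge0_le0 ?exprn_ge0 ?expR_ge0// subr_le0.
apply: (@le_trans _ _ (expR b ^+ n.+1 * (1 - b ^+ 2) ^+ n.+1)); last first.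
  rewrite -exprMn; apply: lerXn2r; rewrite ?nnegrE//.
  by rewrite mulr_ge0 ?expR_ge0// subr_ge0.
apply: ler_wpM2l; first by rewrite exprn_ge0 ?expR_ge0.
have -> : a ^+ 2 / N = b ^+ 2 * N.
  by rewrite -bN expr2 expr2; field; rewrite gt_eqF.
rewrite /N; elim: (n.+1) => [|k IH]; first by rewrite mulr0 subr0 expr0.
rewrite [(1 - _) ^+ _]exprS; apply: (@le_trans _ _ ((1 - b ^+ 2) * (1 - b ^+ 2 * k%:R))); last first.
  by rewrite ler_wpM2l// subr_ge0.
have := mulr_ge0 (sqr_ge0 b) (mulr_ge0 (sqr_ge0 b) (ler0n R k)).
rewrite -[k.+1%:R]natr1; lra.
Unshelve. all: by end_near.
Qed.

Section MatrixExponential.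
Variables (R : realType) (N : nat) (Q : 'M[R]_N.+1).
Implicit Types (t : R) (x y : 'I_N.+1).

(** The entrywise l1 norm: submultiplicative and above every entry, hence a bound for all powers. *)
Definition mx_mass : R := \sum_x \sum_y `|Q x y|.

Lemma mx_mass_ge0 : 0 <= mx_mass.
Proof. by rewrite sumr_ge0// => x _; rewrite sumr_ge0. Qed.

Lemma entry_exp_le k x y : `|(Q ^+ k) x y| <= mx_mass ^+ k.
Proof.
elim: k x y => [|k IH] x y.
  by rewrite !expr0 mxE; case: (x == y); rewrite ?normr1 ?normr0.
rewrite !exprS mxE; apply: le_trans (ler_norm_sum _ _ _) _.
apply: (@le_trans _ _ (\sum_z `|Q x z| * mx_mass ^+ k)).
  by apply: ler_sum => z _; rewrite normrM ler_wpM2l.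
rewrite -mulr_suml ler_wpM2r ?exprn_ge0 ?mx_mass_ge0//.
rewrite /mx_mass [leRHS](bigD1 x)//= lerDl sumr_ge0// => z _; exact: sumr_ge0.
Qed.

Definition exp_term t x y : R^nat :=
  fun k => t ^+ k / (k`!)%:R * (Q ^+ k) x y.

Lemma exp_term_le t x y k : 0 <= t ->
  `|exp_term t x y k| <= exp_coeff (t * mx_mass) k.
Proof.
move=> t0; rewrite /exp_term /exp_coeff /= normrM exprMn [leRHS]mulrAC.
have c0 : 0 <= t ^+ k / k`!%:R by rewrite divr_ge0 ?exprn_ge0 ?ler0n.
by rewrite (ger0_norm c0) ler_wpM2l// entry_exp_le.
Qed.

Lemma transition_cvg t x y : 0 <= t ->
  series (exp_term t x y) @ \oo --> transition Q t x y.
Proof.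
move=> t0; apply: normed_cvg.
apply: series_le_cvg (is_cvg_series_exp_coeff (t * mx_mass)) => k //=.
  by rewrite exp_coeff_ge0// mulr_ge0 ?mx_mass_ge0.
exact: exp_term_le.
Qed.

Lemma euler_binomial (s : R) (k : nat) x y :
  ((1 + s *: Q) ^+ k) x y =
  \sum_(0 <= i < k.+1) s ^+ i * (Q ^+ i) x y *+ 'C(k, i).
Proof.
rewrite exprDn_comm ?summxE; last exact: commr_sym (commr1 _).
by rewrite big_mkord; apply: eq_bigr => i _; rewrite mulmxnE expr1n mul1r exprZn mxE.
Qed.

Lemma ffact_le_exp k i : (k ^_ i <= k ^ i)%N.
Proof.
by elim: i => [//|i IH]; rewrite ffactnSr expnSr leq_mul// leq_subr.
Qed.

(** In the Euler polynomial and in its scalar analogue, degree [i] carries the exponential term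
    times the same factor in [[0, 1]]. The matrix error is therefore dominated by the scalar one
    with rate [mx_mass], which vanishes by [euler_expR]. *)
Lemma euler_transition t x y : 0 <= t ->
  ((1 + (t / k.+1%:R) *: Q) ^+ k.+1) x y @[k --> \oo] --> transition Q t x y.
Proof.
move=> t0; set a := t * mx_mass.
have a0 : 0 <= a by rewrite mulr_ge0 ?mx_mass_ge0.
have scvg := @transition_cvg t x y t0.
(* Partial sums are cut at [k.+2] terms, the length of the Euler polynomial of degree [k.+1]. *)
pose S (k : nat) : R := series (exp_term t x y) k.+2.
have Scvg : S k @[k --> \oo] --> transition Q t x y.
  by rewrite /S; move: scvg; rewrite -(cvg_shiftn 2); under eq_fun do rewrite addn2.
pose U (k : nat) : R := series (exp_coeff a) k.+2.
have Ucvg : U k @[k --> \oo] --> expR a.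
  have := is_cvg_series_exp_coeff a; rewrite /U /expR.
  by rewrite -(cvg_shiftn 2); under eq_fun do rewrite addn2.
have rho k i : (i <= k.+1)%N -> let r : R := ('C(k.+1, i) * i`!)%N%:R / k.+1%:R ^+ i in
    0 <= r <= 1.
  move=> ik /=; rewrite divr_ge0 ?exprn_ge0//= ler_pdivrMr ?exprn_gt0// mul1r.
  by rewrite bin_ffact -natrX ler_nat ffact_le_exp.
have key k : `|S k - ((1 + (t / k.+1%:R) *: Q) ^+ k.+1) x y| <=
    U k - (1 + a / k.+1%:R) ^+ k.+1.
  rewrite euler_binomial exprDn /S /U /series /=.
  rewrite -(big_mkord xpredT (fun i => 1 ^+ (k.+1 - i) * (a / k.+1%:R) ^+ i *+ 'C(k.+1, i))).
  rewrite -!sumrB; apply: le_trans (ler_norm_sum _ _ _) _.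
  rewrite !big_mkord; apply: ler_sum => -[i /= ik] _.
  have /andP[r0 r1] := rho k i ik.
  set r : R := _ / _ in r0 r1.
  have e (z : R) : (z / k.+1%:R) ^+ i *+ 'C(k.+1, i) = r * (z ^+ i / i`!%:R).
    rewrite /r natrM exprMn exprVn -mulr_natr; field.
    by rewrite !expf_neq0 ?pnatr_eq0 -?lt0n ?fact_gt0.
  rewrite expr1n mul1r e -mulrnAl e -[r * _ * _]mulrA.
  rewrite -/(exp_term t x y i) -/(exp_coeff a i).
  rewrite -{1}[exp_term _ _ _ _]mul1r -{1}[exp_coeff _ _]mul1r -!mulrBl.
  by rewrite normrM ger0_norm ?subr_ge0// ler_wpM2l ?subr_ge0// exp_term_le.
have n0 : `|S k - ((1 + (t / k.+1%:R) *: Q) ^+ k.+1) x y| @[k --> \oo] --> 0.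
  apply: (@squeeze_cvgr _ _ _ _ (fun=> 0)
     (fun k => U k - (1 + a / k.+1%:R) ^+ k.+1)).
  - by near=> k; apply/andP; split; [exact: normr_ge0|exact: key].
  - exact: cvg_cst.
  - by rewrite -[X in _ --> X](subrr (expR a)); exact: cvgB Ucvg (euler_expR a0).
have d0 : S k - ((1 + (t / k.+1%:R) *: Q) ^+ k.+1) x y @[k --> \oo] --> 0.
  exact: norm_cvg0 n0.
rewrite -[transition Q t x y]subr0.
suff -> : (fun k => ((1 + (t / k.+1%:R) *: Q) ^+ k.+1) x y) =
    (fun k => S k - (S k - ((1 + (t / k.+1%:R) *: Q) ^+ k.+1) x y)).
  exact: cvgB Scvg d0.
by apply/funext => k; rewrite subKr.
Unshelve. all: by end_near.
Qed.

(** The tail from degree 2 is dominated by [a ^+ 2] times the scalar exponential series. As the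
    remainder is quadratic in [t], the errors of all steps of a fine grid add up to a negligible
    amount. *)
Lemma transition_taylor t x y : 0 <= t <= 1 ->
  `|transition Q t x y - (x == y)%:R - t * Q x y|
    <= t ^+ 2 * (mx_mass ^+ 2 * expR mx_mass).
Proof.
move=> /andP[t0 t1]; set a := t * mx_mass.
have a0 : 0 <= a by rewrite mulr_ge0 ?mx_mass_ge0.
have am : a <= mx_mass by rewrite /a ler_piMl ?mx_mass_ge0.
have scvg : `|series (exp_term t x y) k.+2 - (x == y)%:R - t * Q x y|
    @[k --> \oo] --> `|transition Q t x y - (x == y)%:R - t * Q x y|.
  apply: cvg_norm; apply: cvgB; last exact: cvg_cst.
  apply: cvgB; last exact: cvg_cst.
  have := @transition_cvg t x y t0.
  by rewrite -(cvg_shiftn 2); under eq_fun do rewrite addn2.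
apply: (cvgr_to_le scvg); near=> k.
rewrite /series /= !big_nat_recl//= {1 2}/exp_term !expr0 !expr1 !mxE.
rewrite fact0 (_ : 1`! = 1)%N// !divr1 mul1r.
rewrite (_ : _ - _ - _ = \sum_(0 <= i < k) exp_term t x y i.+2); last by ring.
apply: le_trans (ler_norm_sum _ _ _) _.
apply: (@le_trans _ _ (\sum_(0 <= i < k) a ^+ 2 * exp_coeff a i)).
  apply: ler_sum => i _; apply: le_trans (exp_term_le _ _ _ t0) _.
  rewrite -/a /exp_coeff /= -addn2 addnC exprD -mulrA ler_wpM2l ?sqr_ge0//.
  rewrite ler_wpM2l ?exprn_ge0// lef_pV2 ?posrE ?ltr0n ?fact_gt0// ler_nat.
  by rewrite !factS mulnA leq_pmull.
rewrite -mulr_sumr /a exprMn -mulrA ler_wpM2l ?sqr_ge0// ler_wpM2l ?sqr_ge0//.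
apply: (@le_trans _ _ (expR a)); last by rewrite ler_expR.
rewrite /expR; apply: (@nondecreasing_cvgn_le _ (series (exp_coeff a))).
  by apply: nondecreasing_series => i _ _; exact: exp_coeff_ge0.
exact: is_cvg_series_exp_coeff.
Unshelve. all: by end_near.
Qed.

End MatrixExponential.

(** * Comparison principles for the semigroup *)

Section GeneratorSemigroup.
Variables (R : realType) (N : nat) (q : 'I_N.+1 -> 'I_N.+1 -> R).
Implicit Types (g h : 'I_N.+1 -> R) (s t : R) (x y z : 'I_N.+1).

Definition gen_apply g x : R := \sum_y q x y * (g y - g x).

Definition euler_step s g x : R := g x + s * gen_apply g x.

Definition semigroup t g x : R := \sum_y transition (generator q) t x y * g y.

Lemma generator_mul g x : \sum_y generator q x y * g y = gen_apply g x.
Proof.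
rewrite /gen_apply (bigD1 x)//= [RHS](bigD1 x)//= subrr mulr0 add0r.
rewrite mxE eqxx mulNr mulr_suml -sumrN -big_split /=.
apply: eq_bigr => y yx; rewrite mxE eq_sym (negbTE yx); ring.
Qed.

Lemma euler_iter s k g x :
  \sum_y ((1 + s *: generator q) ^+ k) x y * g y = iter k (euler_step s) g x.
Proof.
elim: k x => [|k IH] x /=.
  rewrite expr0 (bigD1 x)//= mxE eqxx mul1r big1 ?addr0// => y yx.
  by rewrite mxE eq_sym (negbTE yx) mul0r.
rewrite exprS; under eq_bigr do rewrite mxE mulr_suml.
rewrite exchange_big /=.
under eq_bigr do (under eq_bigr do rewrite -mulrA); under eq_bigr do rewrite -mulr_sumr IH.
rewrite /euler_step -[gen_apply _ _]generator_mul mulr_sumr.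
rewrite (bigD1 x)//= [in RHS](bigD1 x)//= addrA; congr (_ + _).
  by rewrite !mxE eqxx mulrDl mul1r mulrA.
by apply: eq_bigr => y yx; rewrite !mxE eq_sym (negbTE yx) add0r mulrA.
Qed.

Lemma euler_semigroup t g x : 0 <= t ->
  iter k.+1 (euler_step (t / k.+1%:R)) g x @[k --> \oo] --> semigroup t g x.
Proof.
move=> t0; under eq_fun do rewrite -euler_iter.
apply: cvg_big; [exact: add_continuous|move=> y _; apply: cvgMr_tmp]; exact: euler_transition.
Qed.

Lemma near_euler_small (t C : R) : 0 <= t -> \forall k \near \oo, t / k.+1%:R * C <= 1.
Proof.
move=> t0; near=> k.
rewrite mulrAC ler_pdivrMr ?ltr0n// mul1r.
apply: (@le_trans _ _ k%:R); last by rewrite ler_nat.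
near: k; exact: nbhs_infty_ger.
Unshelve. all: by end_near.
Qed.

Lemma semigroup_taylor t g x : 0 <= t <= 1 ->
  `|semigroup t g x - g x - t * gen_apply g x| <=
    t ^+ 2 * ((mx_mass (generator q)) ^+ 2 * expR (mx_mass (generator q)) *
      \sum_y `|g y|).
Proof.
move=> t01; rewrite -generator_mul /semigroup mulr_sumr.
have -> : g x = \sum_y (x == y)%:R * g y.
  rewrite (bigD1 x)//= eqxx mul1r big1 ?addr0// => y yx.
  by rewrite eq_sym (negbTE yx) mul0r.
rewrite -!sumrB !mulr_sumr; apply: le_trans (ler_norm_sum _ _ _) _.
apply: ler_sum => y _.
rewrite (_ : _ - _ - _ = (transition (generator q) t x y - (x == y)%:R
  - t * generator q x y) * g y); last ring.
by rewrite normrM mulrA ler_wpM2r// transition_taylor.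
Qed.

Variable C : R.
Hypothesis q_ge0 : forall x y, 0 <= q x y.
Hypothesis q_le : forall x, \sum_y q x y <= C.

Lemma C_ge0 : 0 <= C.
Proof. by apply: le_trans (q_le ord0); exact: sumr_ge0. Qed.

Lemma gen_applyE g x :
  gen_apply g x = \sum_y q x y * g y - (\sum_y q x y) * g x.
Proof.
rewrite /gen_apply mulr_suml -sumrB; apply: eq_bigr => y _; exact: mulrBr.
Qed.

(** For [s * C <= 1] the Euler step is a combination of values of [g] with nonnegative weights; this
    is what lets comparison arguments pass through the scheme. *)
Lemma euler_step_mono s g h x : 0 <= s -> s * C <= 1 ->
  (forall y, g y <= h y) -> euler_step s g x <= euler_step s h x.
Proof.
move=> s0 sC gh; rewrite /euler_step !gen_applyE.
have h1 : \sum_y q x y * g y <= \sum_y q x y * h y.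
  by apply: ler_sum => y _; rewrite ler_wpM2l.
have h2 : 0 <= 1 - s * \sum_y q x y.
  rewrite subr_ge0; apply: le_trans sC; exact: ler_wpM2l.
have h3 := ler_wpM2l s0 h1.
have h4 := ler_wpM2l h2 (gh x).
lra.
Qed.

Lemma gen_apply_cst (a : R) x : gen_apply (fun=> a) x = 0.
Proof. by rewrite /gen_apply big1// => y _; rewrite subrr mulr0. Qed.

Lemma gen_applyD g h x :
  gen_apply (fun y => g y + h y) x = gen_apply g x + gen_apply h x.
Proof.
by rewrite /gen_apply -big_split; apply: eq_bigr => y _ /=; ring.
Qed.

Lemma gen_applyZ (a : R) g x : gen_apply (fun y => a * g y) x = a * gen_apply g x.
Proof.
by rewrite /gen_apply mulr_sumr; apply: eq_bigr => y _ /=; ring.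
Qed.

Lemma iter_euler_cst s k (a : R) x : iter k (euler_step s) (fun=> a) x = a.
Proof.
elim: k x => [//|k IH] x /=.
have -> : iter k (euler_step s) (fun=> a) = fun=> a by apply/funext.
by rewrite /euler_step gen_apply_cst mulr0 addr0.
Qed.

Lemma iter_euler_mono s k g h x : 0 <= s -> s * C <= 1 ->
  (forall y, g y <= h y) ->
  iter k (euler_step s) g x <= iter k (euler_step s) h x.
Proof.
move=> s0 sC gh; elim: k x => [|k IH] x //=; exact: euler_step_mono.
Qed.

(** A discrete Dynkin formula: by monotonicity each Euler step raises the bound by at most
    [s * kappa], and the steps add up to [t]. *)
Lemma semigroup_super t h (kappa : R) x : 0 <= t ->
  (forall y, gen_apply h y <= kappa) -> semigroup t h x <= h x + t * kappa.
Proof.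
move=> t0 hk; apply: (cvgr_to_le (@euler_semigroup t h x t0)).
near=> k; set s := t / k.+1%:R.
have s0 : 0 <= s by rewrite divr_ge0 ?ler0n.
have sC : s * C <= 1 by rewrite /s; near: k; exact: near_euler_small.
have -> : t = k.+1%:R * s by rewrite /s mulrC mulfVK ?pnatr_eq0.
elim: (k.+1) x => [|j IH] x /=; first by rewrite mul0r mul0r addr0.
apply: (@le_trans _ _ (euler_step s (fun y => h y + j%:R * s * kappa) x)).
  exact: euler_step_mono.
rewrite /euler_step gen_applyD gen_apply_cst addr0 -[j.+1%:R]natr1.
have := ler_wpM2l s0 (hk x); lra.
Unshelve. all: by end_near.
Qed.

Lemma transition_ge0 t x y : 0 <= t -> 0 <= transition (generator q) t x y.
Proof.
move=> t0.
suff : 0 <= semigroup t (fun z => (z == y)%:R) x.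
  rewrite /semigroup (bigD1 y)//= eqxx mulr1 big1 ?addr0// => z /negbTE ->.
  by rewrite mulr0.
apply: (cvgr_to_ge (@euler_semigroup t _ x t0)).
near=> k; set s := t / k.+1%:R.
have s0 : 0 <= s by rewrite divr_ge0 ?ler0n.
have sC : s * C <= 1 by rewrite /s; near: k; exact: near_euler_small.
rewrite -(iter_euler_cst s k.+1 0 x); exact: iter_euler_mono.
Unshelve. all: by end_near.
Qed.

Lemma transition_sum t x : 0 <= t -> \sum_y transition (generator q) t x y = 1.
Proof.
move=> t0; have -> : \sum_y transition (generator q) t x y = semigroup t (fun=> 1) x.
  by apply: eq_bigr => y _; rewrite mulr1.
apply: (cvg_unique (@norm_hausdorff _ _) (@euler_semigroup t (fun=> 1) x t0)).
rewrite (_ : (fun k => _) = fun=> 1); first exact: cvg_cst.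
by apply/funext => k; exact: iter_euler_cst.
Qed.

(** Apply [semigroup_super] to minus the indicator of [x], whose generator is at most [C]. *)
Lemma transition_diag_ge t x : 0 <= t -> 1 - t * C <= transition (generator q) t x x.
Proof.
move=> t0; have : semigroup t (fun z => - (z == x)%:R) x <= - (x == x)%:R + t * C.
  apply: semigroup_super => // y; rewrite gen_applyE.
  have h1 : \sum_z q y z * - (z == x)%:R <= 0.
    by apply: sumr_le0 => z _; rewrite mulr_ge0_le0// oppr_le0 ler0n.
  have h2 : \sum_z q y z <= C by [].
  have h3 := C_ge0.
  by case: (y == x) => /=; lra.
rewrite /semigroup (bigD1 x)//= eqxx big1 ?addr0 /=; first lra.
by move=> z /negbTE ->; rewrite oppr0 mulr0.
Qed.

End GeneratorSemigroup.

(** * Coupling of two ordered copies *)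

Section OrderedCoupling.
Variables (R : realType) (N : nat) (q : 'I_N.+1 -> 'I_N.+1 -> R) (C : R).
Hypothesis q_ge0 : forall x y, 0 <= q x y.
Hypothesis q_le : forall x, \sum_y q x y <= C.
Hypothesis q_nn : forall x y : 'I_N.+1, q x y != 0 -> (x <= y.+1)%N && (y <= x.+1)%N.
Implicit Types (g h phi : 'I_N.+1 -> R) (s t : R) (x y z : 'I_N.+1).

(* One Euler step of two independent copies: each moves by nearest-neighbour
   steps and they never move together, so x < y is preserved up to meeting. *)
Lemma euler_pair s g (V : 'I_N.+1 -> R) x y : 0 <= s -> s * (2 * C) <= 1 ->
  (x < y)%N ->
  (forall x' y' : 'I_N.+1, (x' <= y')%N -> `|g x' - g y'| <= V y') ->
  `|euler_step q s g x - euler_step q s g y| <= euler_step q s V y.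
Proof.
move=> s0 sC xy gV; rewrite /euler_step !gen_applyE.
set a := \sum_z q x z; set b := \sum_z q y z.
have aC : a <= C := q_le x.
have bC : b <= C := q_le y.
have ab : 0 <= 1 - s * a - s * b.
  have := ler_wpM2l s0 aC; have := ler_wpM2l s0 bC; lra.
(* Neither copy moves, or the lower one moves to some [z <= y], or the upper one to some [z >= x].
   The upper point is [y] in the first two cases and [z] in the last. *)
rewrite (_ : _ - _ = (1 - s * a - s * b) * (g x - g y)
    + s * (\sum_z q x z * (g z - g y)) + s * (\sum_z q y z * (g x - g z))); last first.
  have -> : \sum_z q x z * (g z - g y) = \sum_z q x z * g z - a * g y.
    by rewrite /a mulr_suml -sumrB; apply: eq_bigr => z _; rewrite mulrBr.
  have -> : \sum_z q y z * (g x - g z) = b * g x - \sum_z q y z * g z.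
    by rewrite /b mulr_suml -sumrB; apply: eq_bigr => z _; rewrite mulrBr.
  ring.
have h1 : `|\sum_z q x z * (g z - g y)| <= a * V y.
  apply: le_trans (ler_norm_sum _ _ _) _; rewrite /a mulr_suml.
  apply: ler_sum => z _; rewrite normrM ger0_norm//.
  have [->|/q_nn/andP[_ zx]] := eqVneq (q x z) 0; first by rewrite !mul0r.
  by apply: ler_wpM2l => //; apply: gV; exact: leq_trans zx xy.
have h2 : `|\sum_z q y z * (g x - g z)| <= \sum_z q y z * V z.
  apply: le_trans (ler_norm_sum _ _ _) _.
  apply: ler_sum => z _; rewrite normrM ger0_norm//.
  have [->|/q_nn/andP[yz _]] := eqVneq (q y z) 0; first by rewrite !mul0r.
  apply: ler_wpM2l => //; apply: gV; rewrite -ltnS; exact: leq_trans xy yz.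
apply: le_trans (ler_normD _ _) _; apply: le_trans (lerD (ler_normD _ _) (lexx _)) _.
rewrite !normrM (ger0_norm ab) !(ger0_norm s0).
have h3 := ler_wpM2l s0 h1; have h4 := ler_wpM2l s0 h2.
have h5 := ler_wpM2l ab (gV x y (ltnW xy)).
lra.
Qed.

(* [h y + (phi y + c (T - t)) / (c T)] dominates the probability that the upper
   of the two copies has not reached 0 after time [t]. *)
Lemma semigroup_contract (T c : R) h phi g x y :
  0 < T -> 0 < c -> (forall z, 0 <= h z) -> (forall z, 0 <= phi z) ->
  (forall z, `|g z| <= 2^-1) ->
  (forall z, [\/ z = ord0, 1 <= h z | gen_apply q h z <= 0 /\ gen_apply q phi z <= - c]) ->
  (x <= y)%N ->
  `|semigroup q T g x - semigroup q T g y| <= h y + phi y / (c * T).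
Proof.
move=> T0 c0 h0 phi0 g1 hyp xy.
have T0' := ltW T0.
have cvgd : `|iter k.+1 (euler_step q (T / k.+1%:R)) g x -
      iter k.+1 (euler_step q (T / k.+1%:R)) g y| @[k --> \oo] -->
    `|semigroup q T g x - semigroup q T g y|.
  by apply: cvg_norm; apply: cvgB; exact: euler_semigroup.
apply: (cvgr_to_le cvgd); near=> k; set s := T / k.+1%:R.
have s0 : 0 <= s by rewrite divr_ge0 ?ler0n.
have sC2 : s * (2 * C) <= 1 by rewrite /s; near: k; exact: near_euler_small.
have sC : s * C <= 1 by have := mulr_ge0 s0 (C_ge0 q_ge0 q_le); lra.
have sk : k.+1%:R * s = T by rewrite /s mulrC mulfVK ?pnatr_eq0.
have bnd j z : `|iter j (euler_step q s) g z| <= 2^-1.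
  rewrite ler_norml; apply/andP; split.
    rewrite -(iter_euler_cst q s j (- 2^-1) z); apply: iter_euler_mono sC _ => // w.
    by have := g1 w; rewrite ler_norml => /andP[].
  rewrite -[leRHS](iter_euler_cst q s j (2^-1) z); apply: iter_euler_mono sC _ => // w.
  by have := g1 w; rewrite ler_norml => /andP[].
pose V (j : nat) z := h z + (phi z / (c * T) + (T - j%:R * s) / T).
have pc z : 0 <= phi z / (c * T) by rewrite divr_ge0// mulr_ge0// ltW.
have rem j : (j <= k.+1)%N -> 0 <= (T - j%:R * s) / T.
  by move=> jk; rewrite divr_ge0// subr_ge0 -[leRHS]sk ler_wpM2r// ler_nat.
have V0 j z : (j <= k.+1)%N -> 0 <= V j z.
  by move=> jk; rewrite /V !addr_ge0 ?pc// rem.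
have -> : h y + phi y / (c * T) = V k.+1 y by rewrite /V sk subrr mul0r addr0.
have : (k.+1 <= k.+1)%N by [].
clear cvgd; elim: {-2}(k.+1) x y xy => [|j IH] x y xy jk.
  apply: le_trans (ler_normB _ _) _; apply: le_trans (lerD (g1 x) (g1 y)) _.
  rewrite /V mul0r subr0 divff ?gt_eqF//.
  have := h0 y; have := pc y; lra.
move: xy; rewrite leq_eqVlt => /orP[/eqP/val_inj ->|xy].
  by rewrite subrr normr0 V0.
(* No pair [x < y] has [y = ord0]; where [1 <= h y] the trivial bound 1 suffices; elsewhere the
   drift of [phi] pays for the elapsed fraction [s / T]. *)
have [y0|hy|[hy py]] := hyp y.
- by move: xy; rewrite y0 ltn0.
- apply: le_trans (ler_normB _ _) _; apply: le_trans (lerD (bnd _ x) (bnd _ y)) _.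
  have := pc y; have := rem _ jk; rewrite /V; lra.
- apply: le_trans (euler_pair s0 sC2 xy (V := V j) _) _ => //.
    by move=> x' y' xy'; apply: IH => //; exact: ltnW.
  rewrite /euler_step /V gen_applyD gen_applyD gen_apply_cst addr0.
  have -> : gen_apply q (fun y0 => phi y0 / (c * T)) y = (c * T)^-1 * gen_apply q phi y.
    by rewrite -gen_applyZ; congr (gen_apply _ _ _); apply/funext => w; rewrite mulrC.
  have h1 : s * ((c * T)^-1 * gen_apply q phi y) <= - (s / T).
    apply: (@le_trans _ _ (s * ((c * T)^-1 * - c))).
      by rewrite ler_wpM2l// ler_wpM2l// invr_ge0 mulr_ge0// ltW.
    rewrite (_ : s * _ = - (s / T))//; field; rewrite !gt_eqF//.
  have h2 := ler_wpM2l s0 hy.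
  rewrite -[j.+1%:R]natr1.
  have -> : (T - (j%:R + 1) * s) / T = (T - j%:R * s) / T - s / T by field; rewrite gt_eqF.
  lra.
Unshelve. all: by end_near.
Qed.

(** Total variation is attained at the test function equal to plus or minus one half according to
    the sign of the difference, to which the contraction estimate applies. *)
Lemma dTV_transition (T c : R) h phi x y :
  0 < T -> 0 < c -> (forall z, 0 <= h z) -> (forall z, 0 <= phi z) ->
  (forall z, [\/ z = ord0, 1 <= h z | gen_apply q h z <= 0 /\ gen_apply q phi z <= - c]) ->
  (x <= y)%N ->
  dTV (transition (generator q) T x) (transition (generator q) T y)
    <= h y + phi y / (c * T).
Proof.
move=> T0 c0 h0 phi0 hyp xy.
pose mu := transition (generator q) T x; pose nu := transition (generator q) T y.
pose g z : R := if 0 <= mu z - nu z then 2^-1 else - 2^-1.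
have -> : dTV mu nu = semigroup q T g x - semigroup q T g y.
  rewrite /dTV mulr_sumr /semigroup -sumrB; apply: eq_bigr => z _.
  rewrite -/mu -/nu -mulrBl /g; case: ifPn => [/ger0_norm ->|]; first by rewrite mulrC.
  by rewrite -ltNge => /ltr0_norm ->; ring.
apply: le_trans (ler_norm _) _; apply: semigroup_contract => // z.
by rewrite /g; case: ifP => _; rewrite ?normrN ger0_norm ?invr_ge0 ?ler0n.
Qed.

End OrderedCoupling.

(** * Hitting times through dyadic skeletons *)

Lemma measure_finType_bigcup (R : realType) (d : measure_display)
    (T : measurableType d) (mu : probability T R) (S : finType) (F : S -> set T) :
  trivIset setT F -> (forall z, measurable (F z)) ->
  mu (\bigcup_z F z) = (\sum_z mu (F z))%E.
Proof.
move=> tF mF; rewrite measure_fin_bigcup//; last exact: finite_finset.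
rewrite (fsbigE (index_enum S)) ?index_enum_uniq//; last first.
  by move=> z _; rewrite mem_index_enum.
by apply: eq_bigl => z; rewrite in_setT.
Qed.

Section SkeletonChain.
Variables (R : realType) (S : finType) (p : R -> S -> S -> R).
Variables (X : markov_chain p) (K : {set S}).
Implicit Types (t s : R) (x y z : S) (l j n : nat).

(** Avoidance at steps 1 to [l] only: the starting point [z] is not tested. *)
Fixpoint avoid s l z : R :=
  if l is l'.+1 then \sum_(z' | z' \notin K) p s z z' * avoid s l' z' else 1.

(** Prescribed states up to index [j], then [l] avoiding steps: the mixed form lets an induction on
    [l] move one step at a time into the prescribed part. *)
Definition avoid_from x s (y : nat -> S) j l : set (mc_space X) :=
  [set w | (forall i, (i <= j)%N -> mc_X x (i%:R * s) w = y i) /\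
           (forall i, (j < i <= j + l)%N -> mc_X x (i%:R * s) w \notin K)].

Lemma measurable_event x t (A : pred S) : 0 <= t ->
  measurable [set w : mc_space X | A (mc_X x t w)].
Proof.
move=> t0; have -> : [set w : mc_space X | A (mc_X x t w)] =
    \bigcup_(z in [set z | A z]) [set w | mc_X x t w = z].
  by apply/seteqP; split=> [w Aw|w [z /= Az wz]]; [exists (mc_X x t w)|rewrite /= wz].
by apply: fin_bigcup_measurable => // z _; exact: mc_measurable.
Qed.

Lemma measurable_forall_event x (c : nat -> Prop) (t : nat -> R) (A : nat -> pred S) :
  (forall i, 0 <= t i) ->
  measurable [set w : mc_space X | forall i, c i -> A i (mc_X x (t i) w)].
Proof.
move=> t0; have -> : [set w : mc_space X | forall i, c i -> A i (mc_X x (t i) w)] =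
    \bigcap_(i in [set i | c i]) [set w | A i (mc_X x (t i) w)] by [].
by apply: bigcap_measurableType => i _; exact: measurable_event.
Qed.

Lemma measurable_avoid_from x s (y : nat -> S) j l : 0 <= s -> measurable (avoid_from x s y j l).
Proof.
move=> s0.
have -> : avoid_from x s y j l =
    [set w : mc_space X | forall i, (i <= j)%N -> pred1 (y i) (mc_X x (i%:R * s) w)] `&`
    [set w : mc_space X | forall i, (j < i <= j + l)%N ->
      [pred z | z \notin K] (mc_X x (i%:R * s) w)].
  apply/seteqP; split=> w [h1 h2]; split=> // i ij; first by rewrite /= h1.
  exact/eqP/(h1 i ij).
have t0 i : 0 <= i%:R * s by rewrite mulr_ge0 ?ler0n.
apply: measurableI.
  exact: (measurable_forall_event x _ (fun i => pred1 (y i)) t0).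
exact: (measurable_forall_event x _ (fun=> [pred z | z \notin K]) t0).
Qed.

Lemma avoid_from_prob x s (y : nat -> S) j l : 0 <= s ->
  mc_P X (avoid_from x s y j l) =
  ((y 0%N == x)%:R * \prod_(i < j) p s (y i) (y i.+1) * avoid s l (y j))%:E.
Proof.
move=> s0; elim: l j y => [|l IH] j y.
  rewrite /= mulr1 -(_ : [set w | forall i, (i <= j)%N -> mc_X x (i%:R * s) w = y i]
    = avoid_from x s y j 0); last first.
    apply/seteqP; split => [w h|w []//]; split => // i.
    by rewrite addn0 => /andP[/leq_trans h1 /h1]; rewrite ltnn.
  rewrite (@mc_fdd _ _ _ X x j (fun i => i%:R * s) y) ?mul0r// => [|i]; last first.
    by rewrite ler_wpM2r// ler_nat.
  by congr ((_ * _)%:E); apply: eq_bigr => i _; rewrite -mulrBl -natrB// subSnn mul1r.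
pose F z : set (mc_space X) := if z \in K then set0 else
  avoid_from x s (fun i => if i == j.+1 then z else y i) j.+1 l.
have FX z w : F z w -> mc_X x (j.+1%:R * s) w = z.
  by rewrite /F; case: ifP => // _ [/(_ j.+1 (leqnn _))]; rewrite eqxx.
have -> : avoid_from x s y j l.+1 = \bigcup_z F z.
  apply/seteqP; split=> w.
    move=> [h1 h2]; exists (mc_X x (j.+1%:R * s) w) => //.
    have jK : mc_X x (j.+1%:R * s) w \notin K by apply: h2; lia.
    rewrite /F (negbTE jK); split=> i ij.
      by case: eqP => [->//|/eqP nj]; apply: h1; lia.
    by apply: h2; lia.
  move=> [z _ Fz]; have := FX _ _ Fz; move: Fz.
  rewrite /F; case: ifPn => // zK [h1 h2] wz; split=> i ij.
    by rewrite h1 ?ifN//; lia.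
  have [->|nj] := eqVneq i j.+1; first by rewrite wz.
  by apply: h2; lia.
rewrite measure_finType_bigcup; last 2 first.
- apply/trivIsetP => z z' _ _ /eqP zz'; apply/seteqP; split=> // w [/FX wz /FX wz'].
  by apply: zz'; rewrite -wz.
- by move=> z; rewrite /F; case: ifP => // _; exact: measurable_avoid_from.
rewrite /= mulr_sumr -sumEFin [RHS]big_mkcond/=; apply: eq_bigr => z _.
rewrite /F; case: ifPn => zK /=; first by rewrite measure0.
rewrite IH eqxx big_ord_recr/= eqxx ltn_eqF// -!mulrA; congr ((_ * _)%:E).
rewrite !mulrA; congr (_ * _ * _); apply: eq_bigr => i _.
by rewrite !ifN//; have := ltn_ord i; lia.
Qed.

(** The finite-dimensional laws also prescribe the state at time 0; summing over it leaves only the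
    true starting point. *)
Lemma law_transition x t y : 0 <= t -> law X x t y = p t x y.
Proof.
move=> t0; rewrite /law.
pose F z : set (mc_space X) :=
  [set w | forall i, (i <= 1)%N -> mc_X x (i%:R * t) w = if i == 0%N then z else y].
have -> : [set w : mc_space X | mc_X x t w = y] = \bigcup_z F z.
  apply/seteqP; split=> w.
    move=> wy; exists (mc_X x 0 w) => // -[|[|i]]//= _; first by rewrite mul0r.
    by rewrite mul1r.
  by move=> [z _ /(_ 1%N isT)]; rewrite mul1r.
have FX z w : F z w -> mc_X x 0 w = z.
  by move=> /(_ 0%N isT); rewrite mul0r.
rewrite measure_finType_bigcup; last 2 first.
- apply/trivIsetP => z z' _ _ /eqP zz'; apply/seteqP; split=> // w [/FX wz /FX wz'].
  by apply: zz'; rewrite -wz.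
- move=> z; have -> : F z = [set w | forall i, (i <= 1)%N ->
      pred1 (if i == 0%N then z else y) (mc_X x (i%:R * t) w)].
    apply/seteqP; split=> w h i i1; first by rewrite /= h.
    exact/eqP/(h i i1).
  apply: (measurable_forall_event x _ (fun i => pred1 (if i == 0%N then z else y))) => i.
  by rewrite mulr_ge0 ?ler0n.
under eq_bigr => z _.
  rewrite /F (@mc_fdd _ _ _ X x 1 (fun i => i%:R * t)
    (fun i => if i == 0%N then z else y)); last 2 first.
  - by rewrite mul0r.
  - by move=> i; rewrite ler_wpM2r// ler_nat.
  rewrite big_ord1 /= mul0r subr0 mul1r.
  over.
rewrite sumEFin /= (bigD1 x)//= eqxx mul1r big1 ?addr0// => z /negbTE ->.
by rewrite mul0r.
Qed.

(** The grid includes time 0, which [avoid] does not see, hence the separate case [x \in K]. *)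
Definition skeleton_avoid t n x : R :=
  if x \in K then 0 else avoid (t / 2 ^+ n) (2 ^ n) x.

Definition skeleton_event x t n : set (mc_space X) :=
  [set w | forall i, (i <= 2 ^ n)%N -> mc_X x (i%:R * (t / 2 ^+ n)) w \notin K].

Lemma measurable_skeleton_event x t n : 0 <= t -> measurable (skeleton_event x t n).
Proof.
move=> t0; apply: (measurable_forall_event x _ (fun=> [pred z | z \notin K])) => i.
by rewrite mulr_ge0 ?ler0n// divr_ge0 ?exprn_ge0.
Qed.

Lemma skeleton_prob x t n : 0 <= t ->
  mc_P X (skeleton_event x t n) = (skeleton_avoid t n x)%:E.
Proof.
move=> t0; set s := t / 2 ^+ n.
have s0 : 0 <= s by rewrite divr_ge0 ?exprn_ge0.
pose F z : set (mc_space X) := if z \in K then set0 else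
  avoid_from x s (fun=> z) 0 (2 ^ n).
have FX z w : F z w -> mc_X x 0 w = z.
  by rewrite /F; case: ifP => // _ [/(_ 0%N isT)]; rewrite mul0r.
have -> : skeleton_event x t n = \bigcup_z F z.
  apply/seteqP; split=> w.
    move=> h; exists (mc_X x 0 w) => //; rewrite /F.
    have := h 0%N isT; rewrite mul0r => /negbTE ->; split=> i.
      by rewrite leqn0 => /eqP ->; rewrite mul0r.
    by rewrite add0n => /andP[_ i2]; exact: h.
  move=> [z _ Fz]; have := FX _ _ Fz; move: Fz.
  rewrite /F; case: ifPn => // zK [_ h] wz [|i] i2; first by rewrite mul0r wz.
  exact: h.
rewrite measure_finType_bigcup; last 2 first.
- apply/trivIsetP => z z' _ _ /eqP zz'; apply/seteqP; split=> // w [/FX wz /FX wz'].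
  by apply: zz'; rewrite -wz.
- by move=> z; rewrite /F; case: ifP => // _; exact: measurable_avoid_from.
have E z : mc_P X (F z) = (if z \in K then 0 else (z == x)%:R * avoid s (2 ^ n) z)%:E.
  rewrite /F; case: ifPn => zK; first by rewrite measure0.
  by rewrite avoid_from_prob// big_ord0 mulr1.
rewrite (eq_bigr _ (fun z _ => E z)) sumEFin (bigD1 x)//= eqxx big1 ?addr0.
  by rewrite /skeleton_avoid -/s mul1r.
by move=> z /negbTE ->; rewrite mul0r; case: ifP.
Qed.

Lemma skeleton_nonincreasing x t n : skeleton_event x t n.+1 `<=` skeleton_event x t n.
Proof.
move=> w h i i2.
have -> : i%:R * (t / 2 ^+ n) = i.*2%:R * (t / 2 ^+ n.+1).
  rewrite -muln2 natrM exprS; field; exact: expf_neq0.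
by apply: h; rewrite expnS mul2n leq_double.
Qed.

(* Right-continuity: a path entering K before t stays there long enough to be
   seen at some dyadic time, and a path outside K at t does not enter at once. *)
Lemma hitting_time_le x t : 0 < t ->
  [set w : mc_space X | (hitting_time x K w <= t%:E)%E] =
  \bigcup_n ~` skeleton_event x t n.
Proof.
move=> t0; apply/seteqP; split=> w; last first.
  move=> [n _ /existsNP[i /not_implyP[i2 /negP/negPn Xi]]] /=.
  apply: (@le_trans _ _ (i%:R * (t / 2 ^+ n))%:E).
    apply: ereal_inf_lbound; exists (i%:R * (t / 2 ^+ n)) => //; split=> //.
    by rewrite mulr_ge0 ?ler0n ?divr_ge0 ?exprn_ge0 ?(ltW t0).
  rewrite lee_fin mulrA ler_pdivrMr ?exprn_gt0// mulrC ler_wpM2l ?(ltW t0)//.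
  by rewrite -natrX ler_nat.
move=> /= ht; apply: contrapT => nh.
have sk n i : (i <= 2 ^ n)%N -> mc_X x (i%:R * (t / 2 ^+ n)) w \notin K.
  move=> i2; apply/negP => Xi; apply: nh; exists n => // /(_ i i2).
  by rewrite Xi.
have Xt : mc_X x t w \notin K.
  have := sk 0%N 1%N isT; by rewrite mul1r expr0 divr1.
have Xs s : 0 <= s -> s <= t -> mc_X x s w \notin K.
  move=> s0; rewrite le_eqVlt => /orP[/eqP ->//|st].
  have [e /= e0 He] := mc_rcont x w s0.
  apply/negP => Xs.
  (* Some dyadic time within [d] after [s] lies both before [t] and in the interval where the path
     is constant. *)
  pose d := Num.min e (t - s).
  have d0 : 0 < d by rewrite lt_min e0 subr_gt0.
  have [n nd] : exists n, t / 2 ^+ n < d.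
    pose n := Num.bound (t / d); exists n.
    rewrite ltr_pdivrMr ?exprn_gt0// mulrC -ltr_pdivrMr//.
    apply: (@lt_le_trans _ _ n%:R); first by rewrite archi_boundP// divr_ge0 ?ltW.
    by rewrite -natrX ler_nat ltnW// ltn_expl.
  pose u := t / 2 ^+ n.
  have u0 : 0 < u by rewrite divr_gt0 ?exprn_gt0.
  pose i := (Num.truncn (s / u)).+1.
  have /andP[i1 i2] : s < i%:R * u <= s + u.
    have := truncn_itv (divr_ge0 s0 (ltW u0)); rewrite -/i => /andP[a b].
    apply/andP; split; first by rewrite -ltr_pdivrMr.
    rewrite -[i%:R]natr1 mulrDl mul1r lerD2r.
    by rewrite -ler_pdivlMr.
  have iu : i%:R * u < s + d by apply: le_lt_trans i2 _; rewrite ltrD2l.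
  have ie : (i <= 2 ^ n)%N.
    have : i%:R * u < t by apply: lt_le_trans iu _; rewrite /d -lerBrDl ge_min lexx orbT.
    rewrite /u mulrA ltr_pdivrMr ?exprn_gt0// mulrC ltr_pM2l//.
    by rewrite -natrX ltr_nat => /ltnW.
  have /negP := sk n i ie; apply; rewrite -/u (He (i%:R * u))//.
  rewrite /ball_ /= distrC ger0_norm ?subr_ge0 ?(ltW i1)// ltrBlDl.
  by apply: lt_le_trans iu _; rewrite lerD2l /d ge_min lexx.
(* The path also stays outside [K] just after [t], so the hitting time is at least [t + e]. *)
have [e /= e0 He] := mc_rcont x w (ltW t0).
have : ((t + e)%:E <= hitting_time x K w)%E.
  apply: le_ereal_inf_tmp => _ [s [s0 sK] <-]; rewrite lee_fin leNgt; apply/negP => se.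
  have [st|ts] := lerP s t; first by move: (Xs s s0 st); rewrite sK.
  move: sK; rewrite (He s)//; first by rewrite (negbTE Xt).
  by rewrite /ball_ /= distrC ger0_norm ?subr_ge0 ?(ltW ts)// ltrBlDl.
move=> /le_trans/(_ ht); rewrite lee_fin gerDl leNgt e0//.
Qed.

(** Continuity from below: refining the grid enlarges the event that [K] is seen. *)
Lemma prob_hit_le_cvg x t : 0 < t ->
  1 - skeleton_avoid t n x @[n --> \oo] --> prob_hit_le X x K t.
Proof.
move=> t0; rewrite /prob_hit_le hitting_time_le//.
have mS n : measurable (~` skeleton_event x t n).
  by apply: measurableC; apply: measurable_skeleton_event; exact: ltW.
have : mc_P X \o (fun n => ~` skeleton_event x t n) @ \oo -->
    mc_P X (\bigcup_n ~` skeleton_event x t n).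
  apply: nondecreasing_cvg_mu => //; first exact: bigcup_measurable.
  apply/nondecreasing_seqP => n; rewrite subsetEset; apply: subsetC.
  exact: skeleton_nonincreasing.
have -> : mc_P X \o (fun n => ~` skeleton_event x t n) =
    fun n => (1 - skeleton_avoid t n x)%:E.
  apply/funext => n /=; rewrite probability_setC.
    by rewrite skeleton_prob ?ltW.
  by apply: measurable_skeleton_event; exact: ltW.
have fin : (mc_P X (\bigcup_n ~` skeleton_event x t n) \is a fin_num).
  by apply: fin_num_measure; exact: bigcup_measurable.
by rewrite -{1}(fineK fin) => /fine_cvgP[].
Qed.

Lemma prob_hit_gtE x t : 0 < t -> prob_hit_gt X x K t = 1 - prob_hit_le X x K t.
Proof.
move=> t0; rewrite /prob_hit_gt /prob_hit_le.
have -> : [set w : mc_space X | (t%:E < hitting_time x K w)%E] =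
    ~` [set w : mc_space X | (hitting_time x K w <= t%:E)%E].
  by apply/seteqP; split=> w /=; rewrite ltNge => /negP.
have m : measurable [set w : mc_space X | (hitting_time x K w <= t%:E)%E].
  rewrite hitting_time_le//; apply: bigcup_measurable => n _.
  by apply: measurableC; apply: measurable_skeleton_event; exact: ltW.
rewrite probability_setC// fineB//; exact: fin_num_measure.
Qed.

End SkeletonChain.

(** * Lyapunov bounds on hitting probabilities *)

Section HittingBounds.
Variables (R : realType) (N : nat) (q : 'I_N.+1 -> 'I_N.+1 -> R) (C : R).
Hypothesis q_ge0 : forall x y, 0 <= q x y.
Hypothesis q_le : forall x, \sum_y q x y <= C.
(** An abstract kernel, so that the bounds serve the chain and its time reversal alike; agreement is
    asked only at nonnegative times. *)
Variable p : R -> 'I_N.+1 -> 'I_N.+1 -> R.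
Hypothesis pE : forall t x y, 0 <= t -> p t x y = transition (generator q) t x y.
Variables (X : markov_chain p) (K : {set 'I_N.+1}).
Implicit Types (g h phi : 'I_N.+1 -> R) (s t : R) (x y z : 'I_N.+1).

Let p_ge0 t x y : 0 <= t -> 0 <= p t x y.
Proof. by move=> t0; rewrite pE// (transition_ge0 q_ge0 q_le). Qed.

Let p_sum t x : 0 <= t -> \sum_y p t x y = 1.
Proof.
move=> t0; rewrite -(transition_sum q x t0).
by apply: eq_bigr => y _; rewrite pE.
Qed.

Let p_semigroup t g x : 0 <= t -> \sum_y p t x y * g y = semigroup q t g x.
Proof. by move=> t0; apply: eq_bigr => y _; rewrite pE. Qed.

(** Induction on the steps: [h] dominates 1 on [K], and each step costs at most [s * kappa] by
    [semigroup_super]. *)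
Lemma avoid_lower h (kappa s : R) l z : 0 <= s -> 0 <= kappa ->
  (forall y, 0 <= h y) -> (forall y, y \in K -> 1 <= h y) ->
  (forall y, gen_apply q h y <= kappa) ->
  1 - avoid p K s l z <= h z + l%:R * s * kappa.
Proof.
move=> s0 k0 h0 hK hk; elim: l z => [|l IH] z /=.
  by rewrite subrr mul0r mul0r addr0.
have := semigroup_super q_ge0 q_le z s0 hk; rewrite -p_semigroup// => hs.
have : 1 - \sum_(z' | z' \notin K) p s z z' * avoid p K s l z' <=
    \sum_z' p s z z' * (h z' + l%:R * s * kappa).
  rewrite -{1}(p_sum z s0) [X in _ - X]big_mkcond -sumrB; apply: ler_sum => z' _.
  case: ifPn => [z'K|/negPn z'K].
    by rewrite -[X in X - _]mulr1 -mulrBr ler_wpM2l// p_ge0.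
  rewrite subr0 -[leLHS]mulr1 ler_wpM2l ?p_ge0//.
  apply: (@le_trans _ _ (h z')); first exact: hK.
  by rewrite lerDl !mulr_ge0 ?ler0n.
move/le_trans; apply; under eq_bigr do rewrite mulrDr.
rewrite big_split /= -mulr_suml p_sum// mul1r -[l.+1%:R]natr1.
lra.
Qed.

Lemma prob_hit_le_super h (kappa t : R) x : 0 < t -> 0 <= kappa ->
  (forall y, 0 <= h y) -> (forall y, y \in K -> 1 <= h y) ->
  (forall y, gen_apply q h y <= kappa) ->
  prob_hit_le X x K t <= h x + t * kappa.
Proof.
move=> t0 k0 h0 hK hk; apply: (cvgr_to_le (@prob_hit_le_cvg _ _ _ X K x t t0)).
near=> n; rewrite /skeleton_avoid; case: ifPn => xK.
  rewrite subr0; apply: le_trans (hK _ xK) _.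
  by rewrite lerDl mulr_ge0// ltW.
have s0 : 0 <= t / 2 ^+ n by rewrite divr_ge0 ?exprn_ge0 ?ltW.
apply: le_trans (avoid_lower (2 ^ n) x s0 k0 h0 hK hk) _.
rewrite natrX (_ : 2 ^+ n * (t / 2 ^+ n) = t)//.
by rewrite mulrC mulfVK// expf_neq0.
Unshelve. all: by end_near.
Qed.

(** Where [g] is below 1, [g + phi / (c * t)] loses at least [s / t] per step to first order, which
    matches the decrease of the remaining fraction of time. The drift is controlled only outside
    [K], so each step is expanded by Taylor, with an error [s ^+ 2 * E] where [E] does not depend on
    the grid. *)
Lemma avoid_upper g phi (c t : R) : 0 < t -> 0 < c ->
  (forall z, 0 <= g z) -> (forall z, 0 <= phi z) ->
  (forall z, z \notin K ->
     1 <= g z \/ gen_apply q g z <= 0 /\ gen_apply q phi z <= - c) ->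
  exists2 E, 0 <= E & forall (s : R) m l z, 0 <= s <= 1 -> m%:R * s = t -> (l <= m)%N ->
    z \notin K ->
    avoid p K s l z <= g z + phi z / (c * t) + (t - l%:R * s) / t + l%:R * (s ^+ 2 * E).
Proof.
move=> t0 c0 g0 phi0 hyp.
pose G z := g z + phi z / (c * t).
have ct0 : 0 < c * t by rewrite mulr_gt0.
have pc z : 0 <= phi z / (c * t) by rewrite divr_ge0// ltW.
exists ((mx_mass (generator q)) ^+ 2 * expR (mx_mass (generator q)) * \sum_y `|G y|).
  by apply: mulr_ge0; [apply: mulr_ge0; [exact: sqr_ge0|exact: expR_ge0]|exact: sumr_ge0].
move=> s m l z /andP[s0 s1] ms lm zK; set E := _ * \sum_y _.
have E0 : 0 <= E.
  by apply: mulr_ge0; [apply: mulr_ge0; [exact: sqr_ge0|exact: expR_ge0]|exact: sumr_ge0].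
have le0 k : 0 <= k%:R * (s ^+ 2 * E) by exact: mulr_ge0 (ler0n _ _) (mulr_ge0 (sqr_ge0 _) E0).
have rem k : (k <= m)%N -> 0 <= (t - k%:R * s) / t.
  move=> km; rewrite divr_ge0 ?(ltW t0)// subr_ge0 -[leRHS]ms.
  by rewrite ler_wpM2r// ler_nat.
elim: l z lm zK => [|l IH] z lm zK /=.
  rewrite !mul0r subr0 divff ?gt_eqF// addr0.
  by have := g0 z; have := pc z; lra.
pose A := (t - l%:R * s) / t + l%:R * (s ^+ 2 * E).
have A0 : 0 <= A by rewrite addr_ge0// rem// ltnW.
have step1 : \sum_(z' | z' \notin K) p s z z' * avoid p K s l z' <=
    semigroup q s G z + A.
  rewrite -p_semigroup// -[A]mul1r -(p_sum z s0) mulr_suml -big_split /=.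
  rewrite big_mkcond /=; apply: ler_sum => z' _; rewrite -mulrDr.
  case: ifPn => z'K; last first.
    by apply: mulr_ge0; [exact: p_ge0|exact: addr_ge0 (addr_ge0 (g0 z') (pc z')) A0].
  by rewrite ler_wpM2l ?p_ge0// /G /A addrA; apply: IH => //; exact: ltnW.
have [g1|[gg gphi]] := hyp z zK.
  have av1 : avoid p K s l.+1 z <= 1.
    elim: (l.+1) z {zK step1 g1} => [//|k IHk] z /=.
    rewrite -(p_sum z s0) big_mkcond /=; apply: ler_sum => z' _.
    by case: ifP => _; rewrite ?p_ge0// ler_piMr ?p_ge0.
  apply: (le_trans av1); have := pc z; have := rem _ lm; have := le0 l.+1; lra.
apply: (le_trans step1).
have s01 : 0 <= s <= 1 by rewrite s0 s1.
have := semigroup_taylor q G z s01; rewrite -/E => /(le_trans (ler_norm _)) tay.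
have gG : gen_apply q G z <= - t^-1.
  rewrite /G gen_applyD.
  have -> : gen_apply q (fun y => phi y / (c * t)) z = (c * t)^-1 * gen_apply q phi z.
    by rewrite -gen_applyZ; congr (gen_apply _ _ _); apply/funext => w; rewrite mulrC.
  have : (c * t)^-1 * gen_apply q phi z <= (c * t)^-1 * - c.
    by rewrite ler_wpM2l// invr_ge0 ltW.
  rewrite (_ : _ * - c = - t^-1); last by field; rewrite !gt_eqF.
  lra.
have h1 := ler_wpM2l s0 gG.
rewrite /A -[l.+1%:R]natr1.
have -> : (t - (l%:R + 1) * s) / t = (t - l%:R * s) / t + s * - t^-1.
  by field; rewrite gt_eqF.
rewrite -/(G z); lra.
Qed.

(** On the grid of [2 ^ n] steps the Taylor errors total [t ^+ 2 * E / 2 ^+ n], which vanishes in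
    the limit. *)
Lemma prob_hit_le_sub g phi (c t : R) x : 0 < t -> 0 < c ->
  (forall z, 0 <= g z) -> (forall z, 0 <= phi z) ->
  (forall z, z \notin K ->
     1 <= g z \/ gen_apply q g z <= 0 /\ gen_apply q phi z <= - c) ->
  1 - (g x + phi x / (c * t)) <= prob_hit_le X x K t.
Proof.
move=> t0 c0 g0 phi0 hyp.
have [E E0 HE] := avoid_upper t0 c0 g0 phi0 hyp.
set B := g x + _.
have B0 : 0 <= B by rewrite addr_ge0// divr_ge0// mulr_ge0// ltW.
have cvgE : 1 - (B + t ^+ 2 * E * n.+1%:R^-1) @[n --> \oo] --> 1 - B.
  apply: cvgB; first exact: cvg_cst.
  rewrite -[X in _ --> X]addr0 -[X in _ --> _ + X](mulr0 (t ^+ 2 * E)).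
  by apply: cvgD; [exact: cvg_cst|apply: cvgMl_tmp; exact: cvg_harmonic].
apply: (ler_cvg_to cvgE (@prob_hit_le_cvg _ _ _ X K x t t0)).
near=> n; rewrite lerD2l lerN2 /skeleton_avoid; case: ifPn => xK.
  by rewrite addr_ge0// mulr_ge0 ?invr_ge0 ?ler0n// mulr_ge0// sqr_ge0.
have s0 : 0 <= t / 2 ^+ n by rewrite divr_ge0 ?exprn_ge0 ?ltW.
have n1 : n.+1%:R <= 2 ^+ n :> R by rewrite -natrX ler_nat ltn_expl.
have s1 : t / 2 ^+ n <= 1.
  rewrite ler_pdivrMr ?exprn_gt0// mul1r; apply: le_trans n1.
  apply: (@le_trans _ _ n%:R); last by rewrite ler_nat.
  near: n; exact: nbhs_infty_ger.
have s01 : 0 <= t / 2 ^+ n <= 1 by rewrite s0 s1.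
have ns : (2 ^ n)%:R * (t / 2 ^+ n) = t.
  by rewrite natrX mulrC mulfVK// expf_neq0.
apply: le_trans (HE _ _ (2 ^ n)%N x s01 ns (leqnn _) xK) _.
rewrite ns subrr mul0r addr0 lerD2l.
rewrite (_ : _%:R * _ = t ^+ 2 * E * (2 ^+ n)^-1); last first.
  by rewrite natrX; field; rewrite expf_neq0.
apply: ler_wpM2l; first by rewrite mulr_ge0 ?sqr_ge0.
by rewrite lef_pV2 ?posrE ?ltr0n ?exprn_gt0.
Unshelve. all: by end_near.
Qed.

(** Staying put at every grid time avoids [K], and [1 - u >= expR (- (2 * u))] for [u] between 0 and
    one half bounds each factor. *)
Lemma prob_hit_le_stay (t : R) x : 0 < t -> x \notin K ->
  prob_hit_le X x K t <= 1 - expR (- (2 * C * t)).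
Proof.
move=> t0 xK; have C0 := C_ge0 q_ge0 q_le.
apply: (cvgr_to_le (@prob_hit_le_cvg _ _ _ X K x t t0)).
near=> n; rewrite /skeleton_avoid (negbTE xK) lerD2l lerN2.
set s := t / 2 ^+ n.
have s0 : 0 <= s by rewrite divr_ge0 ?exprn_ge0 ?ltW.
have sC : s * C <= 2^-1.
  rewrite /s mulrAC ler_pdivrMr ?exprn_gt0//.
  apply: (@le_trans _ _ (2^-1 * n%:R)); last first.
    by rewrite ler_wpM2l// -natrX ler_nat ltnW// ltn_expl.
  rewrite -ler_pdivrMl ?invr_gt0//.
  near: n; exact: nbhs_infty_ger.
have stay : expR (- (2 * C * s)) <= p s x x.
  have := transition_diag_ge q_ge0 q_le x s0; rewrite -pE//.
  apply: le_trans.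
  have sC0 : 0 <= s * C by rewrite mulr_ge0.
  rewrite expRN -[leLHS]mul1r ler_pdivrMr ?expR_gt0//.
  have := expR_ge1Dx (2 * C * s).
  have h1 : 0 <= 1 - s * C by lra.
  move/(ler_wpM2l h1); apply: le_trans.
  have : 0 <= s * C * (1 - 2 * (s * C)) by rewrite mulr_ge0// subr_ge0; lra.
  lra.
have av l : expR (- (2 * C * s)) ^+ l <= avoid p K s l x.
  have av0 k z : 0 <= avoid p K s k z.
    elim: k z => [//|k IH] z /=; apply: sumr_ge0 => z' _.
    by rewrite mulr_ge0 ?p_ge0.
  elim: l => [//|l IH] /=; rewrite (bigD1 x)//= exprS.
  apply: le_trans (ler_pM _ _ stay IH) _; rewrite ?expR_ge0 ?exprn_ge0 ?expR_ge0//.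
  by rewrite lerDl; apply: sumr_ge0 => z' _; rewrite mulr_ge0 ?p_ge0.
apply: le_trans (av _); rewrite -expRM_natr natrX ler_expR.
rewrite (_ : _ * 2 ^+ n = - (2 * C * t))//.
by rewrite /s; field; rewrite expf_neq0.
Unshelve. all: by end_near.
Qed.

End HittingBounds.

(** * Estimates for the birth and death chain *)

Section BirthDeathEstimates.
Variables (R : realType) (n : nat).
Implicit Types (x y z : nat) (g : nat -> R).

Definition theta x : R := (maxn x 1)%:R `^ (3 / 2).

(* The inverse of the unnormalised weight; [resist y] is then the resistance of
   the edge {y, y + 1}. *)
Definition inv_weight x : R := theta x * theta (n - x).

Definition resist y : R := Num.max (inv_weight y) (inv_weight y.+1).

Lemma theta_gt0 x : 0 < theta x.
Proof. by rewrite powR_gt0// ltr0n leq_max orbT. Qed.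

Lemma theta_mono x y : (x <= y)%N -> theta x <= theta y.
Proof.
move=> xy; rewrite /theta ge0_ler_powR ?nnegrE ?ler0n ?divr_ge0// ler_nat; lia.
Qed.

Lemma theta0 : theta 0 = 1.
Proof. by rewrite /theta max0n powR1. Qed.

Lemma inv_weight_gt0 x : 0 < inv_weight x.
Proof. by rewrite mulr_gt0 ?theta_gt0. Qed.

Lemma resist_gt0 x : 0 < resist x.
Proof. by rewrite lt_max inv_weight_gt0. Qed.

Lemma bd_weightE (x : 'I_n.+1) : bd_weight R x = (inv_weight x)^-1.
Proof. by []. Qed.

Lemma bd_weight_sum_gt0 : 0 < \sum_(z < n.+1) bd_weight R z.
Proof.
rewrite (bigD1 ord0)//= ltr_pwDl ?sumr_ge0 ?bd_weightE ?invr_gt0 ?inv_weight_gt0//.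
by move=> z _; rewrite bd_weightE invr_ge0 ltW ?inv_weight_gt0.
Qed.

Lemma bd_pi_gt0 (x : 'I_n.+1) : 0 < bd_pi R n x.
Proof. by rewrite mulr_gt0 ?bd_weightE ?invr_gt0 ?bd_weight_sum_gt0 ?inv_weight_gt0. Qed.

Lemma bd_pi_ratio (x y : 'I_n.+1) :
  bd_pi R n y / bd_pi R n x = inv_weight x / inv_weight y.
Proof.
rewrite /bd_pi !bd_weightE; field.
by rewrite !gt_eqF ?inv_weight_gt0 ?bd_weight_sum_gt0.
Qed.

(** The Metropolis rate with the normalization constant cancelled. Between neighbours the
    denominator is the resistance of the edge, so rate times resistance is [inv_weight x]. *)
Definition jump_rate x y : R := inv_weight x / Num.max (inv_weight x) (inv_weight y).

Lemma bd_rateE (x y : 'I_n.+1) : bd_rate R x y =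
  if (y == x.+1 :> nat) || (x == y.+1 :> nat) then jump_rate x y else 0.
Proof.
rewrite /bd_rate bd_pi_ratio /jump_rate; case: ifP => // _.
have vx := inv_weight_gt0 x; have vy := inv_weight_gt0 y.
case: (lerP (inv_weight x) (inv_weight y)) => h.
  by rewrite min_r// ler_pdivrMr// mul1r.
by rewrite min_l ?divff ?gt_eqF// ler_pdivlMr// mul1r ltW.
Qed.

Lemma jump_rate_ge0 x y : 0 <= jump_rate x y.
Proof. by rewrite divr_ge0 ?le_max ?(ltW (inv_weight_gt0 _)). Qed.

Lemma jump_rate_le1 x y : jump_rate x y <= 1.
Proof.
by rewrite ler_pdivrMr ?lt_max ?inv_weight_gt0// mul1r le_max lexx.
Qed.

Lemma bd_rate_sum (F : nat -> R) (x : 'I_n.+1) :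
  \sum_y bd_rate R x y * F y =
  (if (x < n)%N then jump_rate x x.+1 * F x.+1 else 0) +
  (if (0 < x)%N then jump_rate x x.-1 * F x.-1 else 0).
Proof.
transitivity (\sum_(y < n.+1) ((if y == x.+1 :> nat then jump_rate x x.+1 * F x.+1 else 0) +
   (if x == y.+1 :> nat then jump_rate x x.-1 * F x.-1 else 0))).
  apply: eq_bigr => y _; rewrite bd_rateE.
  case: eqP => [->|_] /=; first by rewrite ifN ?addr0//; lia.
  case: eqP => [->|_] /=; first by rewrite add0r.
  by rewrite mul0r addr0.
rewrite big_split /= -!big_mkcond /=; congr (_ + _).
  case: ifPn => xn.
    by rewrite (big_pred1 (Ordinal (xn : (x.+1 < n.+1)%N))).
  by rewrite big_pred0// => y; apply/negbTE; have := ltn_ord y; lia.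
case: ifPn => x0.
  have xn : (x.-1 < n.+1)%N by have := ltn_ord x; lia.
  rewrite (big_pred1 (Ordinal xn))// => y /=; rewrite -val_eqE /=.
  by apply/eqP/eqP; lia.
by rewrite big_pred0// => y; apply/negbTE; lia.
Qed.

Lemma bd_rate_ge0 (x y : 'I_n.+1) : 0 <= bd_rate R x y.
Proof. by rewrite bd_rateE; case: ifP => // _; exact: jump_rate_ge0. Qed.

Lemma bd_rate_sum_le (x : 'I_n.+1) : \sum_y bd_rate R x y <= 2.
Proof.
have := bd_rate_sum (fun=> 1) x.
rewrite (eq_bigr (fun y : 'I_n.+1 => bd_rate R x y)) => [->|y _]; last by rewrite mulr1.
rewrite !mulr1.
have := jump_rate_le1 x x.+1; have := jump_rate_le1 x x.-1.
by case: ifP => _; case: ifP => _; lra.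
Qed.

Lemma bd_rate_neighbour (x y : 'I_n.+1) :
  bd_rate R x y != 0 -> (x <= y.+1)%N && (y <= x.+1)%N.
Proof.
rewrite bd_rateE; case: ifP => [+ _|]; last by rewrite eqxx.
by move=> /orP[/eqP ->|/eqP ->]; lia.
Qed.

Lemma bd_gen g (x : 'I_n.+1) :
  gen_apply (bd_rate R (n := n)) (fun y : 'I_n.+1 => g y) x =
  (if (x < n)%N then jump_rate x x.+1 * (g x.+1 - g x) else 0) +
  (if (0 < x)%N then jump_rate x x.-1 * (g x.-1 - g x) else 0).
Proof. exact: (bd_rate_sum (fun y => g y - g x)). Qed.

(** * The escape potential *)

Definition potential x : R := \sum_(0 <= y < x) resist y.

(** [uphalf n] is the least point of [bd_G n]; for positive [n] this is the probability of visiting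
    [bd_G n] before 0. *)
Definition escape x : R := potential (minn x (uphalf n)) / potential (uphalf n).

Lemma potential_mono x y : (x <= y)%N -> potential x <= potential y.
Proof.
move=> xy; rewrite /potential (big_cat_nat _ xy)//= lerDl sumr_ge0// => z _.
by rewrite ltW ?resist_gt0.
Qed.

Lemma potential_gt0 : (0 < n)%N -> 0 < potential (uphalf n).
Proof.
move=> n0; apply: (@lt_le_trans _ _ (potential 1)); last by apply: potential_mono; lia.
by rewrite /potential big_nat1 resist_gt0.
Qed.

Lemma potentialS x : potential x.+1 = potential x + resist x.
Proof. by rewrite /potential big_nat_recr. Qed.

Lemma potential_ge0 x : 0 <= potential x.
Proof. by rewrite sumr_ge0// => z _; rewrite ltW ?resist_gt0. Qed.

Lemma escape0 : escape 0 = 0.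
Proof. by rewrite /escape min0n /potential big_nil mul0r. Qed.

Lemma escape_ge0 x : 0 <= escape x.
Proof. by rewrite divr_ge0 ?potential_ge0. Qed.

Lemma escape_le1 x : (0 < n)%N -> escape x <= 1.
Proof.
by move=> n0; rewrite ler_pdivrMr ?potential_gt0// mul1r potential_mono ?geq_minr.
Qed.

Lemma escape_G x : (0 < n)%N -> (n <= 2 * x)%N -> escape x = 1.
Proof.
move=> n0 xG; rewrite /escape (minn_idPr _) ?divff ?gt_eqF ?potential_gt0//; lia.
Qed.

Lemma escapeS x : (2 * x < n)%N ->
  escape x.+1 - escape x = resist x / potential (uphalf n).
Proof.
move=> xA; rewrite /escape !(minn_idPl _); [|lia|lia].
by rewrite potentialS -mulrBl [potential x + _]addrC addrK.
Qed.

Lemma jump_resist x : jump_rate x x.+1 * resist x = inv_weight x.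
Proof. by rewrite mulfVK// gt_eqF// resist_gt0. Qed.

Lemma jump_resist_pred x : (0 < x)%N -> jump_rate x x.-1 * resist x.-1 = inv_weight x.
Proof.
case: x => // x _; rewrite /jump_rate /resist /= maxC mulfVK// gt_eqF//.
exact: resist_gt0.
Qed.

(** Rate times increment is the same flow [inv_weight x / potential (uphalf n)] across both edges at
    [x], so the two contributions cancel. *)
Lemma gen_escape_interior (x : 'I_n.+1) : (0 < x)%N -> (2 * x < n)%N ->
  gen_apply (bd_rate R (n := n)) (fun y : 'I_n.+1 => escape y) x = 0.
Proof.
move=> x0 xA; rewrite bd_gen x0 (_ : (x < n)%N) ?escapeS//; last by lia.
have -> : escape x.-1 - escape x = - (resist x.-1 / potential (uphalf n)).
  by rewrite -escapeS ?prednK// ?opprB//; lia.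
by rewrite mulrN !mulrA jump_resist jump_resist_pred// subrr.
Qed.

(** The generator vanishes in the interior and is nonpositive on G, where [escape] is maximal; the
    bound is its value at 0. *)
Lemma gen_escape_le (x : 'I_n.+1) : (0 < n)%N ->
  gen_apply (bd_rate R (n := n)) (fun y : 'I_n.+1 => escape y) x <=
  theta n / potential (uphalf n).
Proof.
move=> n0; have k0 : 0 <= theta n / potential (uphalf n).
  by rewrite divr_ge0 ?potential_ge0 ?(ltW (theta_gt0 _)).
have [x0|x0] := posnP x.
  rewrite bd_gen x0 n0 /= addr0 escapeS ?muln0// mulrA jump_resist /inv_weight.
  by rewrite theta0 mul1r subn0.
have [xA|xG] := ltnP (2 * x) n; first by rewrite gen_escape_interior.
apply: le_trans k0; rewrite bd_gen x0 (escape_G (x := x))//.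
rewrite (escape_G (x := x.+1))//; last by lia.
rewrite subrr mulr0 if_same add0r.
by rewrite mulr_ge0_le0 ?jump_rate_ge0// subr_le0 escape_le1.
Qed.

Lemma theta_ge_quarter x : (n <= 4 * x)%N -> (n%:R / 4) `^ (3 / 2) <= theta x.
Proof.
move=> nx; rewrite /theta ge0_ler_powR ?nnegrE ?ler0n ?divr_ge0 ?ler0n//.
by rewrite ler_pdivrMr// -natrM ler_nat; lia.
Qed.

(** At least [n / 8] edges lie between [n / 4] and [n / 2], each of resistance at least
    [(n / 4) ^ 3]. *)
Definition potential_floor : R := (n%:R / 4) ^+ 3 * (n%:R / 8).

Lemma potential_floor_gt0 : (0 < n)%N -> 0 < potential_floor.
Proof. by move=> n0; rewrite mulr_gt0 ?exprn_gt0 ?divr_gt0 ?ltr0n. Qed.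

Lemma potential_lower : (8 <= n)%N -> potential_floor <= potential (uphalf n).
Proof.
move=> n8; pose a := ((n + 3) %/ 4)%N.
have am : (a <= uphalf n)%N by rewrite /a; lia.
rewrite /potential (big_cat_nat _ am)//=.
apply: (@le_trans _ _ (\sum_(a <= y < uphalf n) (n%:R / 4) ^+ 3)); last first.
  apply: ler_wpDl; first exact: potential_ge0.
  apply: ler_sum_nat => y /andP[ay ym].
  apply: (@le_trans _ _ (inv_weight y)); last by rewrite le_max lexx.
  have h : (3 / 2 + 3 / 2 : R) = 3%:R by lra.
  have -> : (n%:R / 4) ^+ 3 = (n%:R / 4) `^ (3 / 2) * (n%:R / 4) `^ (3 / 2) :> R.
    rewrite -powRD ?h ?powR_mulrn ?divr_ge0 ?ler0n//.
    by rewrite pnatr_eq0.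
  by apply: ler_pM; rewrite ?powR_ge0//; apply: theta_ge_quarter; lia.
rewrite sumr_const_nat -[leRHS]mulr_natr.
have h : (n%:R / 8 : R) <= (uphalf n - a)%:R.
  by rewrite ler_pdivrMr// -natrM ler_nat /a; lia.
by rewrite ler_wpM2l// exprn_ge0 ?divr_ge0 ?ler0n.
Qed.

(** Below the midpoint [n - z <= 4 * (n - x)]; taking 4 rather than 2 makes the constant
    [4 ^ (3/2) = 8] an integer. *)
Lemma inv_weight_le8 z x : (z <= x)%N -> (2 * x < n)%N -> inv_weight z <= 8 * inv_weight x.
Proof.
move=> zx xA; rewrite /inv_weight mulrCA.
apply: ler_pM; rewrite ?(ltW (theta_gt0 _))//; first exact: theta_mono.
apply: (@le_trans _ _ (theta (4 * (n - x)))); first by apply: theta_mono; lia.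
rewrite /theta (_ : maxn (4 * (n - x)) 1 = (4 * maxn (n - x) 1)%N); last by lia.
rewrite natrM powRM ?ler0n// ler_wpM2r ?powR_ge0//.
rewrite (_ : 4%:R = 2 `^ 2 :> R); last by rewrite powR_mulrn -?natrX.
by rewrite -powRrM (_ : 2 * (3 / 2) = 3%:R :> R) ?powR_mulrn -?natrX; last lra.
Qed.

Lemma potential_upper x : (2 * x < n)%N -> potential x <= 8 * n%:R * inv_weight x.
Proof.
move=> xA; apply: (@le_trans _ _ (\sum_(0 <= y < x) 8 * inv_weight x)).
  apply: ler_sum_nat => y /andP[_ yx].
  by rewrite ge_max !inv_weight_le8//; exact: ltnW.
rewrite sumr_const_nat subn0 -[leLHS]mulr_natr mulrAC ler_wpM2r ?(ltW (inv_weight_gt0 _))//.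
by rewrite ler_wpM2l// ler_nat; lia.
Qed.

(** * The parabola and the drift towards 0 *)

Definition parabola x : R := x%:R * (2 * n%:R + 1 - x%:R).

Lemma parabola_ge0 x : (x <= n)%N -> 0 <= parabola x.
Proof.
move=> xn; have : x%:R <= n%:R :> R by rewrite ler_nat.
have : 0 <= x%:R :> R by rewrite ler0n.
by move=> a b; rewrite mulr_ge0//; lra.
Qed.

Lemma parabola_le x : (x <= n)%N -> parabola x <= 3 * n%:R ^+ 2.
Proof.
case: x => [|x] xn; first by rewrite /parabola mul0r mulr_ge0 ?sqr_ge0.
have h1 : x.+1%:R <= n%:R :> R by rewrite ler_nat.
have h2 : 1 <= x.+1%:R :> R by rewrite ler1n.
rewrite /parabola; nra.
Qed.

Lemma jump_down_ge8 x : (0 < x)%N -> (2 * x < n)%N -> 8^-1 <= jump_rate x x.-1.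
Proof.
move=> x0 xA; rewrite ler_pdivlMr ?lt_max ?inv_weight_gt0// ler_pdivrMl//.
by rewrite ge_max !inv_weight_le8//; lia.
Qed.

(** Comparing resistances reduces to [inv_weight x.-1 <= inv_weight x.+1], an inequality between
    products of integers raised to the power 3/2. *)
Lemma jump_up_le_down x : (4 <= n)%N -> (0 < x)%N -> (2 * x < n)%N ->
  jump_rate x x.+1 <= jump_rate x x.-1.
Proof.
move=> n4 x0 xA; rewrite ler_wpM2l ?(ltW (inv_weight_gt0 _))//.
rewrite lef_pV2 ?posrE ?lt_max ?inv_weight_gt0//.
rewrite ge_max le_max lexx /= le_max; apply/orP; right.
rewrite /inv_weight /theta -!powRM ?ler0n// -!natrM.
rewrite ge0_ler_powR ?nnegrE ?ler0n ?divr_ge0// ler_nat.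
have -> : maxn (n - x.-1) 1 = (n - x).+1 by lia.
have -> : maxn x.+1 1 = x.+1 by lia.
have -> : maxn (n - x.+1) 1 = (n - x).-1 by lia.
(* At [x = 1] the truncation replaces [x.-1] by 1 and leaves [n <= 2 * (n - 2)]: hence [4 <= n]. *)
have [->|x1] := eqVneq x 1%N; first by lia.
have -> : maxn x.-1 1 = x.-1 by lia.
have [k nk] : exists k, (n = 2 * x + k.+1)%N by exists (n - 2 * x).-1; lia.
have -> : (n - x = x + k.+1)%N by lia.
case: x x0 xA x1 nk => // x _ _ _ _; rewrite /=; nia.
Qed.

(** The downward increment exceeds the upward one by 2 in size, and the downward rate is the larger
    one and at least [8^-1]: the drift is at most [- 2 * 8^-1]. *)
Lemma gen_parabola (x : 'I_n.+1) : (4 <= n)%N -> (0 < x)%N -> (2 * x < n)%N ->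
  gen_apply (bd_rate R (n := n)) (fun y : 'I_n.+1 => parabola y) x <= - 4^-1.
Proof.
move=> n4 x0 xA; rewrite bd_gen x0 (_ : (x < n)%N); last by lia.
have up : parabola x.+1 - parabola x = 2 * (n%:R - x%:R).
  by rewrite /parabola -[x.+1%:R]natr1; ring.
have down : parabola x.-1 - parabola x = - (2 * (n%:R - x%:R) + 2).
  rewrite /parabola -[in x%:R](prednK x0) -[x.-1.+1%:R]natr1; ring.
rewrite up down.
have h1 := jump_up_le_down n4 x0 xA; have h2 := jump_down_ge8 x0 xA.
have h3 : 0 <= 2 * (n%:R - x%:R) :> R.
  by rewrite mulr_ge0// subr_ge0 ler_nat -ltnS ltn_ord.
have := ler_wpM2r h3 h1; lra.
Qed.

(* Fast-decaying increments absorb an arbitrarily strong upward drift, hence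
   this Lyapunov function works on the whole of {1, ..., n}. *)
Definition slope : R := (theta n * theta n)^-1 / 2.

Definition geometric x : R := \sum_(0 <= i < x) slope ^+ i.

Lemma slope_gt0 : 0 < slope.
Proof. by rewrite divr_gt0 ?invr_gt0 ?mulr_gt0 ?theta_gt0. Qed.

Lemma theta_ge1 x : 1 <= theta x.
Proof. by rewrite -theta0; exact: theta_mono. Qed.

Lemma slope_le1 : slope <= 1.
Proof.
rewrite /slope ler_pdivrMr// mul1r invf_ple ?posrE ?mulr_gt0 ?theta_gt0//.
apply: (@le_trans _ _ 1); first by rewrite invf_le1//; lra.
by rewrite -[leLHS]mul1r ler_pM ?theta_ge1.
Qed.

Lemma geometric_ge0 x : 0 <= geometric x.
Proof. by rewrite sumr_ge0// => i _; rewrite exprn_ge0 ?(ltW slope_gt0). Qed.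

Lemma geometric_le x : (x <= n)%N -> geometric x <= n%:R.
Proof.
move=> xn; apply: (@le_trans _ _ (\sum_(0 <= i < x) 1)).
  by apply: ler_sum_nat => i _; rewrite exprn_ile1 ?slope_le1 ?(ltW slope_gt0).
by rewrite sumr_const_nat subn0 ler_nat.
Qed.

Lemma gen_geometric (x : 'I_n.+1) : (0 < x)%N ->
  gen_apply (bd_rate R (n := n)) (fun y : 'I_n.+1 => geometric y) x <= - slope ^+ n.
Proof.
move=> x0; have xn : (x <= n)%N by rewrite -ltnS.
have s0 := slope_gt0; have s1 := slope_le1.
have st : slope ^+ n <= slope ^+ x.
  by apply: ler_wiXn2l => //; exact: ltW.
have gS k : geometric k.+1 - geometric k = slope ^+ k.
  by rewrite /geometric big_nat_recr//= addrC addrK.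
(* All inverse weights lie in [[1, theta n ^+ 2]], so the downward rate is at least [2 * slope]; the
   geometric increment then beats an upward rate of 1. *)
have d : 2 * slope <= jump_rate x x.-1.
  rewrite /slope mulrC mulfVK ?pnatr_eq0// ler_pdivlMr ?lt_max ?inv_weight_gt0//.
  rewrite ler_pdivrMl ?mulr_gt0 ?theta_gt0//.
  have le (k : nat) : (k <= n)%N -> inv_weight k <= theta n * theta n.
    move=> kn; rewrite /inv_weight; apply: ler_pM; rewrite ?(ltW (theta_gt0 _))//;
      apply: theta_mono; lia.
  have v1 : 1 <= inv_weight x by rewrite -[leLHS]mul1r ler_pM ?theta_ge1.
  apply: (@le_trans _ _ (theta n * theta n)).
    by rewrite ge_max !le//; lia.
  by rewrite -[leLHS]mulr1 ler_wpM2l// mulr_ge0 ?(ltW (theta_gt0 _)).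
have down : geometric x.-1 - geometric x = - slope ^+ x.-1.
  by rewrite -gS prednK// opprB.
have xS : slope ^+ x = slope * slope ^+ x.-1 by rewrite -exprS prednK.
have p0 : 0 <= slope ^+ x.-1 by rewrite exprn_ge0// ltW.
have h1 := ler_wpM2r p0 d.
have h2 : jump_rate x x.+1 * slope ^+ x <= slope ^+ x.
  by rewrite ler_piMl ?jump_rate_le1// exprn_ge0// ltW.
have h3 : 0 <= slope ^+ x by rewrite exprn_ge0// ltW.
by rewrite bd_gen x0 gS down; case: ifP => _; lra.
Qed.

(** * Reversibility *)

Lemma bd_generator_reversible (x y : 'I_n.+1) :
  bd_pi R n x * generator (bd_rate R (n := n)) x y =
  bd_pi R n y * generator (bd_rate R (n := n)) y x.
Proof.
have [->//|xy] := eqVneq x y.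
rewrite !mxE (negbTE xy) eq_sym (negbTE xy) /bd_rate.
rewrite [(x == y.+1 :> nat) || _]orbC; case: ifP => _; last by rewrite !mulr0.
(* Detailed balance: the Metropolis flow is symmetric, being the minimum of the two masses. *)
have flow (a b : R) : 0 < a -> a * Num.min 1 (b / a) = Num.min a b.
  by move=> a0; rewrite minr_pMr ?ltW// mulr1 mulrC mulfVK// gt_eqF.
by rewrite !flow ?bd_pi_gt0// minC.
Qed.

Lemma bd_generator_exp_reversible k (x y : 'I_n.+1) :
  bd_pi R n x * (generator (bd_rate R (n := n)) ^+ k) x y =
  bd_pi R n y * (generator (bd_rate R (n := n)) ^+ k) y x.
Proof.
elim: k x y => [|k IH] x y.
  rewrite !expr0 !mxE eq_sym; case: eqP => [->//|_]; by rewrite !mulr0.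
rewrite [in RHS]exprSr exprS !mxE !mulr_sumr; apply: eq_bigr => z _.
rewrite mulrA bd_generator_reversible mulrAC IH; ring.
Qed.

(** Symmetry of all powers of the generator passes to the exponential series, so every bound on the
    chain holds for its reversal. *)
Lemma reversed_bd_transition (t : R) (x y : 'I_n.+1) : 0 <= t ->
  reversed (bd_pi R n) (bd_transition R n) t x y = bd_transition R n t x y.
Proof.
move=> t0; rewrite /reversed /bd_transition.
set Q := generator _.
have px := bd_pi_gt0 x; have py := bd_pi_gt0 y.
have c1 := @transition_cvg R n Q t x y t0.
have c2 : bd_pi R n y * series (exp_term Q t y x) k * (bd_pi R n x)^-1 @[k --> \oo] -->
    bd_pi R n y * transition Q t y x / bd_pi R n x.
  by apply: cvgMr_tmp; apply: cvgMl_tmp; exact: transition_cvg.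
apply: (cvg_unique (@norm_hausdorff _ _) c2); apply: cvg_trans c1.
apply: near_eq_cvg; near=> k; rewrite /series /= mulr_sumr mulr_suml.
apply: eq_bigr => i _; rewrite /exp_term.
have e := bd_generator_exp_reversible i x y; rewrite -/Q in e.
rewrite [bd_pi R n y * _]mulrCA -e; set c := t ^+ i / _; field; by rewrite gt_eqF.
Unshelve. all: by end_near.
Qed.

End BirthDeathEstimates.

(** * The general hypotheses at a fixed size *)

Lemma bd_G_complement n (x : 'I_n.+1) : (x \in ~: bd_G n) = (2 * x < n)%N.
Proof. by rewrite !inE -ltnNge. Qed.

Lemma dTV_sym (R : realType) (S : finType) (mu nu : S -> R) : dTV mu nu = dTV nu mu.
Proof. by rewrite /dTV; congr (_ * _); apply: eq_bigr => x _; rewrite distrC. Qed.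

Lemma thermalization_of_ordered (R : realType) n
    (X : markov_chain (bd_transition R n)) (K : {set 'I_n.+1}) (T d : R) :
  0 <= T -> 0 <= d ->
  (forall x y : 'I_n.+1, x \in K -> y \in K -> (x <= y)%N ->
    dTV (bd_transition R n T x) (bd_transition R n T y) <= d) ->
  dbar X K T <= d.
Proof.
move=> T0 d0 h; rewrite /dbar; apply: bigmax_le => // x xK.
apply: bigmax_le => // y yK.
have lawE z : law X z T = bd_transition R n T z.
  by apply/funext => w; exact: law_transition.
rewrite !lawE; have [xy|yx] := leqP x y; first exact: h.
by rewrite dTV_sym; apply: h => //; exact: ltnW.
Qed.

Lemma restricted_sum_eq1 (R : realType) (S : finType) (pi : S -> R) (A : {set S}) :
  0 < \sum_(z in A) pi z -> \sum_(x in A) restricted pi A x = 1.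
Proof.
move=> s0; rewrite -mulr_suml (eq_bigr pi); first by rewrite divff// gt_eqF.
by move=> x ->.
Qed.

Lemma bd_pi_A_gt0 (R : realType) n : (0 < n)%N -> 0 < \sum_(z in ~: bd_G n) bd_pi R n z.
Proof.
move=> n0; rewrite (bigD1 ord0) ?bd_G_complement ?muln0//=.
rewrite ltr_pwDl ?bd_pi_gt0// sumr_ge0// => z _.
exact: ltW (bd_pi_gt0 _ _).
Qed.

(** * Hitting and mixing bounds for the birth and death chain *)

Section BirthDeathHitting.
Variables (R : realType) (n : nat).
Hypothesis n8 : (8 <= n)%N.
Variable p : R -> 'I_n.+1 -> 'I_n.+1 -> R.
Hypothesis pE : forall t x y, 0 <= t -> p t x y = bd_transition R n t x y.
Variable X : markov_chain p.
Variable T : R.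
Hypothesis T0 : 0 < T.
Implicit Types x y z : 'I_n.+1.

Let q := bd_rate R (n := n).
Let h x := escape R n x.
Let phi x := parabola R n x.

Let n0 : (0 < n)%N. Proof. exact: leq_trans n8. Qed.

Let F0 : 0 < potential_floor R n. Proof. exact: potential_floor_gt0. Qed.

Let phi_ge0 x : 0 <= phi x.
Proof. by apply: parabola_ge0; rewrite -ltnS. Qed.

(** The parabola is at most [3 n^2] and its drift at most [- 1/4], whence [12 = 3 * 4]. *)
Let phi_T x : phi x / (4^-1 * T) <= 12 * n%:R ^+ 2 / T.
Proof.
rewrite invfM invrK mulrA ler_wpM2r ?invr_ge0 ?(ltW T0)//.
have := @parabola_le R n x; rewrite -ltnS ltn_ord => /(_ isT); rewrite -/(phi x); lra.
Qed.

Lemma bd_hit_le_upper x :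
  prob_hit_le X x (bd_G n) T <= escape R n x + T * (theta R n / potential_floor R n).
Proof.
apply: (@prob_hit_le_super _ _ q 2 _ _ p pE X (bd_G n) h _ T x) => //.
- exact: bd_rate_ge0.
- exact: bd_rate_sum_le.
- exact: divr_ge0 (ltW (theta_gt0 _ _)) (ltW F0).
- by move=> y; exact: escape_ge0.
- by move=> y; rewrite inE => yG; rewrite /h escape_G.
- move=> y; apply: le_trans (gen_escape_le _ _ n0) _.
  rewrite ler_wpM2l ?(ltW (theta_gt0 _ _))// lef_pV2 ?posrE ?potential_gt0//.
  exact: potential_lower.
Qed.

(** The comparison function is [g = 1 - escape], equal to 1 at 0 and harmonic between 0 and G. *)
Lemma bd_hit_le_lower x :
  escape R n x - 12 * n%:R ^+ 2 / T <= prob_hit_le X x (bd_G n) T.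
Proof.
have := @prob_hit_le_sub _ _ q 2 (@bd_rate_ge0 R n) (@bd_rate_sum_le R n) p pE X
  (bd_G n) (fun z => 1 - h z) phi 4^-1 T x T0 _ _ phi_ge0 _.
have := phi_T x; rewrite -/(h x).
move=> ph H; apply: le_trans (H _ _ _); first lra.
- by rewrite invr_gt0.
- by move=> z; rewrite subr_ge0 escape_le1.
- move=> z; rewrite -finset.in_setC bd_G_complement => zA.
  have [z0|z0] := posnP z; [left|right].
    by rewrite /h z0 escape0 subr0.
  split; last exact: gen_parabola (leq_trans _ n8) z0 zA.
  rewrite gen_applyD gen_apply_cst add0r.
  have -> : (fun y => - h y) = (fun y => -1 * h y) by apply/funext => w; rewrite mulN1r.
  by rewrite gen_applyZ gen_escape_interior// mulr0.
Qed.

Lemma bd_hit_gt_le (K : {set 'I_n.+1}) x : ord0 \in K -> bd_G n \subset K ->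
  prob_hit_gt X x K T <= 12 * n%:R ^+ 2 / T.
Proof.
move=> K0 GK; rewrite prob_hit_gtE//.
have := @prob_hit_le_sub _ _ q 2 (@bd_rate_ge0 R n) (@bd_rate_sum_le R n) p pE X
  K (fun=> 0) phi 4^-1 T x T0 _ _ phi_ge0 _.
have := phi_T x.
move=> ph H; rewrite lerBlDl -lerBlDr.
apply: (@le_trans _ _ (1 - (0 + phi x / (4^-1 * T)))).
  by rewrite add0r lerD2l lerN2.
apply: H => //.
move=> z zK; right; rewrite gen_apply_cst; split => //.
apply: gen_parabola.
- exact: leq_trans n8.
- by rewrite lt0n; apply: contra zK => /eqP z0; rewrite (_ : z = ord0)//; exact: val_inj.
- by rewrite -bd_G_complement inE; apply: contra zK => /(fintype.subsetP GK).
Qed.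

Lemma bd_dTV_le x y : (x <= y)%N ->
  dTV (bd_transition R n T x) (bd_transition R n T y) <=
  escape R n y + 12 * n%:R ^+ 2 / T.
Proof.
move=> xy; apply: le_trans (_ : _ <= h y + phi y / (4^-1 * T)) _; last by rewrite lerD2l.
apply: (@dTV_transition R n q 2 (@bd_rate_ge0 R n) (@bd_rate_sum_le R n)
  (@bd_rate_neighbour R n)) => //.
- by move=> z; exact: escape_ge0.
- move=> z; have [z0|z0] := posnP z; first by apply: Or31; exact: val_inj.
  have [zA|zG] := ltnP (2 * z) n; last by apply: Or32; rewrite /h escape_G.
  apply: Or33; split; first by rewrite gen_escape_interior.
  exact: gen_parabola (leq_trans _ n8) z0 zA.
Qed.

(** Bounding the mass of A below by that of 0 replaces the density by [theta n / inv_weight x], and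
    [potential_upper] cancels [inv_weight x]: all terms share one bound, and there are at most
    [n + 1 <= 2 n] of them. *)
Lemma bd_escape_mean :
  \sum_(x in ~: bd_G n) restricted (bd_pi R n) (~: bd_G n) x * escape R n x <=
  8 * n%:R * (2 * n%:R) * (theta R n / potential_floor R n).
Proof.
have pA : bd_pi R n ord0 <= \sum_(z in ~: bd_G n) bd_pi R n z.
  rewrite (bigD1 ord0) ?bd_G_complement ?muln0//= lerDl sumr_ge0// => z _.
  exact: ltW (bd_pi_gt0 _ _).
have th : inv_weight R n 0 = theta R n by rewrite /inv_weight theta0 mul1r subn0.
have term x : x \in ~: bd_G n ->
    restricted (bd_pi R n) (~: bd_G n) x * escape R n x <=
    8 * n%:R * (theta R n / potential_floor R n).
  move=> xA; rewrite /restricted xA; move: xA; rewrite bd_G_complement => xA.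
  have v0 := inv_weight_gt0 R n x.
  apply: (@le_trans _ _ (bd_pi R n x / bd_pi R n ord0 * escape R n x)).
    rewrite ler_wpM2r ?escape_ge0// ler_wpM2l ?(ltW (bd_pi_gt0 _ _))//.
    by rewrite lef_pV2 ?posrE ?bd_pi_gt0 ?bd_pi_A_gt0.
  rewrite bd_pi_ratio /= th /escape (minn_idPl _); last by lia.
  have P0 : 0 < potential R n (uphalf n) by exact: potential_gt0.
  apply: (@le_trans _ _ (theta R n / inv_weight R n x *
      (8 * n%:R * inv_weight R n x / potential_floor R n))).
    rewrite ler_wpM2l ?divr_ge0 ?(ltW (theta_gt0 _ _)) ?(ltW v0)//.
    apply: ler_pM; rewrite ?potential_ge0 ?invr_ge0 ?potential_ge0//.
      exact: potential_upper.
    by rewrite lef_pV2 ?posrE//; exact: potential_lower.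
  rewrite le_eqVlt; apply/orP; left; apply/eqP; field.
  by rewrite !gt_eqF.
apply: (@le_trans _ _ (\sum_(x in ~: bd_G n)
    8 * n%:R * (theta R n / potential_floor R n))); first exact: ler_sum.
rewrite sumr_const -[leLHS]mulr_natr.
rewrite [leRHS]mulrAC.
rewrite ler_wpM2l ?mulr_ge0 ?ler0n ?invr_ge0 ?(ltW (theta_gt0 _ _)) ?(ltW F0)//.
rewrite -natrM ler_nat; apply: leq_trans (max_card _) _.
by rewrite card_ord; lia.
Qed.

End BirthDeathHitting.

Lemma HpG_large (R : realType) (n : nat) (alpha T d f r : R)
    (X : markov_chain (bd_transition R n))
    (Xrev : markov_chain (reversed (bd_pi R n) (bd_transition R n))) :
  (8 <= n)%N -> alpha <= 1 -> 0 < T -> 0 < f <= 1 ->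
  8 * n%:R * (2 * n%:R) * (theta R n / potential_floor R n) +
    2 * T * (theta R n / potential_floor R n) <= f ->
  f `^ alpha + 18 * n%:R ^+ 2 / T <= d ->
  12 * n%:R ^+ 2 / T < r ->
  HpG X Xrev (bd_G n) alpha T d f r.
Proof.
move=> n8 a1 T0 /andP[f0 f1] hf hd hr.
have n0 : (0 < n)%N by exact: leq_trans n8.
have T20 : 0 < 2 * T by rewrite mulr_gt0.
have th0 : 0 < theta R n by exact: theta_gt0.
set kT := 2 * T * _ in hf.
have up x := bd_hit_le_upper n8 (fun _ _ _ _ => erefl) X T20 x.
have upr x := bd_hit_le_upper n8 (@reversed_bd_transition R n) Xrev T20 x.
set mean := 8 * _ * _ * _ in hf.
have mean0 : 0 <= mean.
  by rewrite !mulr_ge0 ?ler0n ?invr_ge0 ?(ltW th0) ?(ltW (potential_floor_gt0 R n0)).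
have ffa : f <= f `^ alpha by rewrite ger1_powR ?f0.
(* From 0 the hitting probability is at most [f], which is at most its power [alpha]. *)
have B0 : ord0 \in B_alpha X Xrev (bd_G n) alpha T f.
  rewrite inE bd_G_complement muln0 n0 /= /avg_hit.
  have := up ord0; have := upr ord0; rewrite /= escape0 -/kT; lra.
split.
- rewrite /slow_escape /f_A.
  set A := ~: bd_G n.
  apply: le_trans hf.
  apply: (@le_trans _ _ (\sum_(x in A) (restricted (bd_pi R n) A x * escape R n x +
      restricted (bd_pi R n) A x * kT))); last first.
    rewrite big_split /= -mulr_suml restricted_sum_eq1 ?bd_pi_A_gt0// mul1r.
    by rewrite lerD2r; exact: bd_escape_mean.
  rewrite mulr_sumr; apply: ler_sum => x xA.
  have w0 : 0 <= restricted (bd_pi R n) A x.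
    by rewrite /restricted xA divr_ge0 ?(ltW (bd_pi_gt0 _ _)) ?(ltW (bd_pi_A_gt0 _ _)).
  have h1 := ler_wpM2l w0 (up x); have h2 := ler_wpM2l w0 (upr x).
  rewrite -/kT in h1 h2; lra.
- have nT : 0 <= n%:R ^+ 2 / T by rewrite divr_ge0 ?sqr_ge0 ?ltW.
  apply: thermalization_of_ordered; [exact: ltW|apply: le_trans hd|].
    by rewrite addr_ge0 ?powR_ge0// -mulrA mulr_ge0.
  move=> x y _ yB xy.
  apply: le_trans (bd_dTV_le n8 T0 xy) _; apply: le_trans hd.
  move: yB; rewrite inE => /andP[_]; rewrite /avg_hit.
  have := bd_hit_le_lower n8 (fun _ _ _ _ => erefl) X T20 y.
  have := bd_hit_le_lower n8 (@reversed_bd_transition R n) Xrev T20 y.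
  (* At time [2 * T] the parabola costs [6 n^2 / T], and the coupling adds [12 n^2 / T]: together
     the 18 in [hd]. *)
  have -> : 12 * n%:R ^+ 2 / (2 * T) = 6 * (n%:R ^+ 2 / T) by field; rewrite gt_eqF.
  lra.
- rewrite /fast_recurrence; apply: bigmax_lt => [|x _].
    by apply: le_lt_trans hr; rewrite divr_ge0 ?(ltW T0)// mulr_ge0 ?sqr_ge0.
  apply: le_lt_trans hr; apply: bd_hit_gt_le => //.
    by rewrite finset.in_setU B0.
  exact: finset.subsetUr.
Qed.

(** [f] is the bound of [prob_hit_le_stay] at time [2 * T] with [C = 2], valid at every point
    outside G. So [B_alpha] is all of A and recurrence is immediate; it is thermalization that asks
    for a huge [T]. *)
Lemma HpG_small (R : realType) (n : nat) (alpha T : R)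
    (X : markov_chain (bd_transition R n))
    (Xrev : markov_chain (reversed (bd_pi R n) (bd_transition R n))) :
  (0 < n)%N -> alpha <= 1 -> 0 < T -> 2 * n%:R / slope R n ^+ n <= T ->
  HpG X Xrev (bd_G n) alpha T 2^-1 (1 - expR (- (2 * 2 * (2 * T)))) 2^-1.
Proof.
move=> n0 a1 T0 hT; set f := 1 - _.
have T20 : 0 < 2 * T by rewrite mulr_gt0.
have f0 : 0 < f by rewrite subr_gt0 expR_lt1 oppr_lt0 !mulr_gt0.
have f1 : f <= 1 by rewrite gerBl expR_ge0.
have ffa : f <= f `^ alpha by rewrite ger1_powR ?f0.
have st x : x \in ~: bd_G n -> prob_hit_le X x (bd_G n) (2 * T) <= f.
  rewrite finset.in_setC => xA.
  exact: (prob_hit_le_stay (@bd_rate_ge0 R n) (@bd_rate_sum_le R n)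
    (fun _ _ _ _ => erefl) X T20 xA).
have str x : x \in ~: bd_G n -> prob_hit_le Xrev x (bd_G n) (2 * T) <= f.
  rewrite finset.in_setC => xA.
  exact: (prob_hit_le_stay (@bd_rate_ge0 R n) (@bd_rate_sum_le R n)
    (@reversed_bd_transition R n) Xrev T20 xA).
have Ball : B_alpha X Xrev (bd_G n) alpha T f = ~: bd_G n.
  apply/setP => x; rewrite inE; case: (boolP (x \in ~: bd_G n)) => //= xA.
  apply: le_trans ffa; rewrite /avg_hit.
  have := st x xA; have := str x xA; lra.
split.
- rewrite /slow_escape /f_A.
  set A := ~: bd_G n in st str *.
  apply: (@le_trans _ _ (\sum_(x in A) restricted (bd_pi R n) A x * f)); last first.
    by rewrite -mulr_suml restricted_sum_eq1 ?bd_pi_A_gt0// mul1r.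
  rewrite mulr_sumr; apply: ler_sum => x xA.
  have w0 : 0 <= restricted (bd_pi R n) A x.
    by rewrite /restricted xA divr_ge0 ?(ltW (bd_pi_gt0 _ _)) ?(ltW (bd_pi_A_gt0 _ _)).
  have h1 := ler_wpM2l w0 (st x xA); have h2 := ler_wpM2l w0 (str x xA); lra.
- apply: thermalization_of_ordered; [exact: ltW|by rewrite invr_ge0|].
  move=> x y _ _ xy.
  have c0 : 0 < slope R n ^+ n by rewrite exprn_gt0 ?slope_gt0.
  (* Coupling with [h = 0]: [geometric] drives the upper copy to 0 from anywhere, and the lower
     bound on [T] leaves at most one half. *)
  apply: (@le_trans _ _ (0 + geometric R n y / (slope R n ^+ n * T))).
    apply: (@dTV_transition R n (bd_rate R (n := n)) 2 (@bd_rate_ge0 R n)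
      (@bd_rate_sum_le R n) (@bd_rate_neighbour R n) T (slope R n ^+ n) (fun=> 0)
      (fun z => geometric R n z)) => // z.
      exact: geometric_ge0.
    have [z0|z0] := posnP z; first by apply: Or31; exact: val_inj.
    by apply: Or33; rewrite gen_apply_cst; split => //; exact: gen_geometric.
  rewrite add0r ler_pdivrMr ?mulr_gt0//.
  move: hT; rewrite ler_pdivrMr// => hT.
  have := @geometric_le R n y; rewrite -ltnS ltn_ord => /(_ isT); lra.
- rewrite /fast_recurrence Ball; apply: bigmax_lt => [|x _]; first by rewrite invr_gt0.
  rewrite prob_hit_gtE//.
  (* The target is the whole space, so the drift conditions are vacuous and hitting has probability
     1. *)
  have := @prob_hit_le_sub _ _ _ 2 (@bd_rate_ge0 R n) (@bd_rate_sum_le R n) _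
    (fun _ _ _ _ => erefl) X (~: bd_G n :|: bd_G n) (fun=> 0) (fun=> 0) 1 T x T0
    ltr01 (fun _ => lexx _) (fun _ => lexx _) _.
  rewrite mul0r addr0 => H.
  suff : 1 - 0 <= prob_hit_le X x (~: bd_G n :|: bd_G n) T.
    have : (0 : R) < 2^-1 by rewrite invr_gt0.
    clear; lra.
  by apply: H => z; rewrite finset.setUC finset.setUCr inE.
Qed.

(** * Asymptotics *)

Lemma powR_natr_cvg0 (R : realType) (s : R) : 0 < s ->
  n%:R `^ (- s) @[n --> \oo] --> (0 : R).
Proof.
move=> s0; apply/cvgr0Pnorm_lt => e e0; near=> n.
have n1 : (0 < n)%N by near: n; exists 1%N.
rewrite ger0_norm ?powR_ge0// powRN invf_plt ?posrE ?powR_gt0 ?ltr0n//.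
have -> : e^-1 = (e^-1 `^ s^-1) `^ s by rewrite -powRrM mulVf ?gt_eqF// powRr1 ?invr_ge0 ?ltW.
apply: gt0_ltr_powR => //; rewrite ?nnegrE ?powR_ge0 ?ler0n//.
by near: n; exact: nbhs_infty_gtr.
Unshelve. all: by end_near.
Qed.

Lemma is_o1_power (R : realType) (c s : R) : 0 < c -> 0 < s ->
  is_o1 (fun n => c * n%:R `^ (- s)).
Proof.
move=> c0 s0; split.
  by exists 1%N => // n /= n1; rewrite mulr_gt0 ?powR_gt0 ?ltr0n.
rewrite -[X in _ --> X](mulr0 c); apply: cvgMl_tmp; exact: powR_natr_cvg0.
Qed.

Lemma is_o1_add (R : realType) (u v : nat -> R) :
  is_o1 u -> is_o1 v -> is_o1 (fun n => u n + v n).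
Proof.
move=> [u0 uc] [v0 vc]; split.
  by near=> n; rewrite addr_gt0//; near: n.
by rewrite -[X in _ --> X]addr0; exact: cvgD.
Unshelve. all: by end_near.
Qed.

(** Finitely many terms may be replaced freely, which lets the small [n] use their own
    parameters. *)
Lemma is_o1_eventually (R : realType) (N : nat) (u v : nat -> R) :
  is_o1 u -> is_o1 (fun n => if (N <= n)%N then u n else v n).
Proof.
move=> [u0 uc]; split.
  near=> n; rewrite ifT; first by near: n.
  by near: n; exists N.
apply: cvg_trans uc; apply: near_eq_cvg; near=> n; rewrite /= ifT//.
by near: n; exists N.
Unshelve. all: by end_near.
Qed.

Lemma is_o1_lt1 (R : realType) (u : nat -> R) :
  is_o1 u -> \forall n \near \oo, 0 < u n < 1.
Proof.
move=> [u0 uc]; near=> n; apply/andP; split; first by near: n.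
near: n; apply: (cvgr_lt (0 : R)) => //; exact: ltr01.
Unshelve. all: by end_near.
Qed.

Lemma thetaE (R : realType) n : (0 < n)%N -> theta R n = n%:R `^ (3 / 2).
Proof. by move=> n0; rewrite /theta (maxn_idPl n0). Qed.

(* [8 * 4 ^ 3] comes from [potential_floor]; [18 = 16 + 2] adds the two terms of
   the slow-escape bound. *)
Definition escape_const (R : realType) : R := 18 * (8 * 4 ^+ 3).

(** The slow-escape bound rests on [theta n / potential_floor n] being a constant times
    [n ^ (-5/2)]. *)
Lemma large_scale_bounds (R : realType) (alpha delta : R) (n : nat) :
  (0 < n)%N -> 0 < delta < 1 / 2 ->
  let T := n%:R `^ (5 / 2 - delta) in
  let f := escape_const R * n%:R `^ (- delta) in
  [/\ 8 * n%:R * (2 * n%:R) * (theta R n / potential_floor R n) +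
        2 * T * (theta R n / potential_floor R n) <= f,
      f `^ alpha = escape_const R `^ alpha * n%:R `^ (- (delta * alpha)) &
      n%:R ^+ 2 / T = n%:R `^ (- (1 / 2 - delta))].
Proof.
move=> n0 /andP[d0 d1] T f.
have nR : n%:R != 0 :> R by rewrite pnatr_eq0 -lt0n.
have nX (k : nat) : n%:R ^+ k = n%:R `^ k%:R :> R by rewrite powR_mulrn.
have pD (a b : R) : n%:R `^ a * n%:R `^ b = n%:R `^ (a + b).
  by rewrite powRD// nR implybT.
have K0 : 0 <= 8 * 4 ^+ 3 :> R by rewrite mulr_ge0 ?exprn_ge0.
split; last 2 first.
- by rewrite /f powRM ?powR_ge0 ?mulr_ge0// -powRrM mulNr.
- rewrite nX /T -powRN pD; congr (_ `^ _); lra.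
have q52 : theta R n / potential_floor R n = 8 * 4 ^+ 3 * n%:R `^ (- (5 / 2)).
  have -> : potential_floor R n = n%:R ^+ 4 / (8 * 4 ^+ 3).
    by rewrite /potential_floor; field.
  rewrite thetaE// invfM invrK mulrA mulrC; congr (_ * _).
  rewrite nX -powRN pD; congr (_ `^ _); lra.
rewrite /f /escape_const; move: K0 q52; set K := 8 * 4 ^+ 3 => K0 ->.
have -> : 8 * n%:R * (2 * n%:R) * (K * n%:R `^ (- (5 / 2))) =
    16 * (K * n%:R `^ (- (1 / 2))).
  transitivity (16 * (K * (n%:R ^+ 2 * n%:R `^ (- (5 / 2))))); first by ring.
  rewrite nX pD; congr (_ * (_ * _ `^ _)); lra.
have -> : 2 * T * (K * n%:R `^ (- (5 / 2))) = 2 * (K * n%:R `^ (- delta)).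
  transitivity (2 * (K * (T * n%:R `^ (- (5 / 2))))); first by ring.
  rewrite /T pD; congr (_ * (_ * _ `^ _)); lra.
(* The mean escape term, of order [n ^ (-1/2)], is absorbed because [delta < 1/2]. *)
have : n%:R `^ (- (1 / 2)) <= n%:R `^ (- delta) :> R.
  by apply: ler_powR; [rewrite ler1n|lra].
move=> /(ler_wpM2l K0); lra.
Qed.

(** * Choice of scales and conclusion *)

Unset Implicit Arguments.

Theorem theorem4p1 (R : realType) (alpha : R) (halpha : 0 < alpha < 1) :
  exists2 eps0 : R, 0 < eps0 & forall eps : R, 0 < eps < eps0 ->
  exists T d f r : nat -> R,
    [/\ is_o1 d, is_o1 f, is_o1 r,
        much_less (fun n => n%:R `^ (5 / 2 - eps)) T
      & forall n : nat, n%:R `^ alpha < n%:R / 2 ->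
        [/\ 1 < T n, 0 < d n < 1, 0 < f n < 1, 0 < r n < 1
          & forall (X : markov_chain (bd_transition R n))
                   (Xrev : markov_chain
                             (reversed (bd_pi R n) (bd_transition R n))),
            HpG X Xrev (bd_G n) alpha (T n) (d n) (f n) (r n)]].
Proof.
have /andP[a0 a1] := halpha.
(* [eps < 1] gives [delta < 1/2], which keeps [T] well above [n ^ 2]; halving [eps] leaves a factor
   [n ^ (- delta)] in the comparison with [n ^ (5/2 - eps)]. *)
exists 1 => // eps /andP[e0 e1].
pose delta := eps / 2.
have d0 : 0 < delta by rewrite divr_gt0.
have d1 : delta < 1 / 2 by rewrite ltr_pM2r// invr_gt0.
have d01 : 0 < delta < 1 / 2 by rewrite d0.
have b5 : 0 < 5 / 2 - delta by lra.
pose TL (n : nat) : R := n%:R `^ (5 / 2 - delta).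
pose fL (n : nat) : R := escape_const R * n%:R `^ (- delta).
pose dL (n : nat) : R := escape_const R `^ alpha * n%:R `^ (- (delta * alpha))
  + 18 * n%:R `^ (- (1 / 2 - delta)).
(* 13 rather than 12, as recurrence is a strict inequality. *)
pose rL (n : nat) : R := 13 * n%:R `^ (- (1 / 2 - delta)).
have b0 : 0 < 1 / 2 - delta by rewrite subr_gt0.
have c0 : 0 < escape_const R by rewrite !mulr_gt0 ?exprn_gt0.
have of' : is_o1 fL by exact: is_o1_power.
have od : is_o1 dL.
  by apply: is_o1_add; apply: is_o1_power; rewrite ?powR_gt0 ?mulr_gt0.
have or' : is_o1 rL by exact: is_o1_power.
have [N _ HN] : \forall n \near \oo,
    [/\ (8 <= n)%N, 0 < dL n < 1, 0 < fL n < 1 & 0 < rL n < 1].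
  near=> n; split; [by near: n; exists 8%N|near: n; exact: is_o1_lt1
    |near: n; exact: is_o1_lt1|near: n; exact: is_o1_lt1].
(* The summand 2 ensures [1 < T]; the other one is the threshold of [HpG_small]. *)
pose TS (n : nat) : R := 2 + 2 * n%:R / slope R n ^+ n.
pose fS (n : nat) : R := 1 - expR (- (2 * 2 * (2 * TS n))).
exists (fun n => if (N <= n)%N then TL n else TS n),
  (fun n => if (N <= n)%N then dL n else 2^-1),
  (fun n => if (N <= n)%N then fL n else fS n),
  (fun n => if (N <= n)%N then rL n else 2^-1).
split; [exact: is_o1_eventually|exact: is_o1_eventually|exact: is_o1_eventually| |].
  have := is_o1_power (ltr01 : 0 < (1 : R)) d0.
  (* The exponent rule is applied to a nonzero base, so the comparison starts at [maxn N 1]. *)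
  move=> /(@is_o1_eventually R (maxn N 1) _
    (fun n => n%:R `^ (5 / 2 - eps) / (if (N <= n)%N then TL n else TS n))).
  rewrite /much_less; congr is_o1; apply/funext => n.
  case: ifPn => //; rewrite geq_max => /andP[-> n1].
  rewrite mul1r /TL -powRN -powRD ?pnatr_eq0 -?lt0n ?n1 ?implybT//.
  congr (_ `^ _); rewrite /delta; lra.
move=> n hn; case: ifPn => Nn.
  have [n8 dn fn rn] := HN n Nn.
  have n0 : (0 < n)%N by exact: leq_trans n8.
  have [h1 h2 h3] := large_scale_bounds alpha n0 d01.
  have T1 : 1 < TL n.
    have -> : (1 : R) = 1 `^ (5 / 2 - delta) by rewrite powR1.
    rewrite (gt0_ltr_powR b5) ?nnegrE ?ler0n ?ler01 ?ltr1n//.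
    exact: leq_trans n8.
  split=> // X Xrev; apply: HpG_large => //.
  - exact: ltW.
  - exact: lt_trans T1.
  - by case/andP: fn => -> /ltW.
  - by rewrite h2 -mulrA h3.
  - by rewrite -mulrA h3 /rL ltr_pM2r ?powR_gt0 ?ltr0n// ltr_nat.
(* The hypothesis excludes [n = 0], where its right-hand side is 0. *)
have n0 : (0 < n)%N.
  by case: n hn {Nn} => //; rewrite mul0r ltNge powR_ge0.
have sn : 0 <= 2 * n%:R / slope R n ^+ n.
  by rewrite divr_ge0 ?mulr_ge0 ?ler0n// exprn_ge0// ltW// slope_gt0.
have T2 : 2 <= TS n by rewrite lerDl.
have T0 : 0 < TS n by exact: lt_le_trans T2.
have half : 0 < (2^-1 : R) < 1.
  by rewrite invr_gt0 ltr0n invf_lt1 ?ltr0n ?ltr1n.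
split=> //.
- by apply: lt_le_trans T2; rewrite ltr1n.
- by rewrite subr_gt0 expR_lt1 oppr_lt0 !mulr_gt0//= gtrBl expR_gt0.
move=> X Xrev; apply: HpG_small => //; first exact: ltW.
by rewrite lerDr.
Unshelve. all: by end_near.
Qed.
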